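(* There exists a standard Gaussian vector $X=(X_1,X_2,X_3,X_4)$ with nonnegative correlations such that $X^0$ is not a color process. Moreover, $X$ can be taken to be either fully supported or not fully supported (i.e. there is such an $X$ which is fully supported on $\mathbb{R}^4$, and there is such an $X$ which is not).
   Context: A $\{0,1\}$-valued process $(Y_i)_{i\in S}$ is a color process (divide and color process) if there are $p\in[0,1]$ and a random partition $\pi$ of $S$ such that $(Y_i)$ has the same law as the process obtained by sampling $\pi$ and then, independently of $\pi$ and independently for different partition elements, assigning all elements of a partition element the value $1$ with probability $p$ and the value $0$ with probability $1-p$. For a random vector $X=(X_i)$ and $h\in\mathbb{R}$, $X^h=(X^h_i)$ with $X^h_i=I(X_i>h)$. A Gaussian vector is standard if each marginal has mean zero and variance one. All Gaussian vectors are assumed nondegenerate: $P(X_i\ne X_j)=1$ for $i\neq j$. A random vector in $\mathbb{R}^n$ is fully supported if the support of its law is all of $\mathbb{R}^n$. *)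

(* Defs.v *)
From HB Require Import structures.
From mathcomp Require Import all_boot all_order all_algebra.
From mathcomp Require Import all_classical all_reals all_analysis.
Import Order.TTheory GRing.Theory Num.Theory.
Import numFieldNormedType.Exports.

Set Implicit Arguments.
Unset Strict Implicit.
Unset Printing Implicit Defensive.

Local Open Scope classical_set_scope.
Local Open Scope ring_scope.

Section gaussian_vectors.
Context {R : realType} {d : measure_display} {T : measurableType d}.

(* [normal_prob m 0] is not the point mass at [m] in the library, so the case
   of zero standard deviation is treated separately. *)
Definition gaussian_law (m s : R) (A : set R) : \bar R :=
  if s == 0 then \d_m A else normal_prob m s A.

Context (P : probability T R) (n : nat).
Implicit Types X : 'I_n -> {RV P >-> R}.

Definition gaussian_vector X : Prop :=
  forall a : 'I_n -> R, exists m s : R, forall A : set R, measurable A ->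
    P ((fun t => \sum_(i < n) a i * X i t) @^-1` A) = gaussian_law m s A.

Definition standard_gaussian_vector X : Prop :=
  gaussian_vector X /\
  (forall i, 'E_P[X i] = 0)%E /\ (forall i, 'V_P[X i] = 1)%E.

Definition nondegenerate_vector X : Prop :=
  forall i j, i != j -> P [set t | X i t != X j t] = 1%E.

(* Only meaningful for standard vectors, where the variances are 1 and the
   correlations are therefore the covariances. *)
Definition nonnegative_correlations X : Prop :=
  forall i j, (0 <= covariance P (X i) (X j))%E.

Definition law_support X : set 'rV[R]_n :=
  [set x | forall e : R, 0 < e ->
    (0 < P [set t | ball x e (\row_(i < n) X i t)])%E].

Definition fully_supported X : Prop := law_support X = setT.

Definition threshold (h : R) X : 'I_n -> T -> bool := fun i t => h < X i t.

End gaussian_vectors.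

(* [part] is a random partition of the finite set [S]; every subset [B] of [S]
   receives a colour [c B], and the colours are i.i.d. Bernoulli([p]) and
   independent of [part]. All these variables take finitely many values, so this
   is the product formula for the joint probability mass function. *)
Definition divide_and_color {R : realType} {d : measure_display}
    {T : measurableType d} (P : probability T R) (S : finType) (p : R)
    (part : T -> {set {set S}}) (c : {set S} -> T -> bool) : Prop :=
  (forall Q, measurable [set t | part t = Q]) /\
  (forall t, finset.partition (part t) [set: S]%SET) /\
  (forall B, measurable_fun setT (c B)) /\
  (forall (Q : {set {set S}}) (e : {set S} -> bool),
    P [set t | part t = Q /\ forall B, c B t = e B] =
    (P [set t | part t = Q] * (\prod_(B : {set S}) bernoulli_pmf p (e B))%:E)%E).

(* For finite [S] two processes have the same law when they give the same
   probability to every configuration [y]. *)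
Definition color_process {R : realType} {d : measure_display}
    {T : measurableType d} (P : probability T R) (S : finType)
    (Y : S -> T -> bool) : Prop :=
  exists p : R, 0 <= p <= 1 /\
  exists (d' : measure_display) (T' : measurableType d')
    (P' : probability T' R) (part : T' -> {set {set S}})
    (c : {set S} -> T' -> bool),
    divide_and_color P' p part c /\
    forall y : S -> bool,
      P [set t | forall i, Y i t = y i] =
      P' [set t | forall i, c (finset.pblock (part t) i) t = y i].

(* Main.v *)
(* For X1, X2, X3 independent standard normal, a color process with the law of
   X^0 would almost surely separate 1, 2 and 3, so that the events "4 lies in the
   block of i", i = 1, 2, 3, would be disjoint. In general, counting the distinct
   pairs among the blocks of four points gives
     [b1 <> b2] + [b1 <> b3] + [b2 <> b3]
       <= [b1 <> b4] + [b2 <> b4] + [b3 <> b4] + 1,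
   and as two distinct blocks disagree in color with probability
   2p(1 - p) <= 1/2, every color process satisfies
     P(Y1 <> Y2) + P(Y1 <> Y3) + P(Y2 <> Y3)
       <= P(Y1 <> Y4) + P(Y2 <> Y4) + P(Y3 <> Y4) + 1/2.
   Let X4 = r (X1 + X2 + X3) + s Z with Z a fourth independent normal and
   3 r^2 + s^2 = 1. The left-hand side is 3/2, while P(Yi <> Y4) is arccos(r) / pi,
   which is < 1/3 as soon as r > 1/2: the right-hand side is then < 3/2. Only the
   comparison of arccos(r) with 60 degrees matters, so no arccosine is needed. The choice
   r = 4/7, s = 1/7 is fully supported and r = 1/sqrt 3, s = 0 is not. *)

From HB Require Import structures.
Require Import Defs.
From mathcomp Require Import all_boot all_order all_algebra.
From mathcomp Require Import all_classical all_reals all_analysis.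
From mathcomp Require Import measurable_realfun normal_distribution ring lra.
Import Order.TTheory GRing.Theory Num.Theory.
Import numFieldNormedType.Exports.

Set Implicit Arguments.
Unset Strict Implicit.
Unset Printing Implicit Defensive.

Local Open Scope classical_set_scope.
Local Open Scope ring_scope.

(** * Measure-theoretic preliminaries *)

Lemma measurable_preimageT d d' (T : measurableType d) (U : measurableType d')
    (f : T -> U) (B : set U) :
  measurable_fun setT f -> measurable B -> measurable (f @^-1` B).
Proof. by move=> mf mB; rewrite -[X in measurable X]setTI; exact: mf. Qed.

Lemma measurable_gt0 d (T : measurableType d) (R : realType) (f : T -> R) :
  measurable_fun setT f -> measurable [set t | 0 < f t].
Proof.
move=> mf; rewrite (_ : [set t | _] = f @^-1` `]0, +oo[%classic).
  by apply: measurable_preimageT.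
by apply/seteqP; split => t; rewrite /= in_itv/= andbT.
Qed.

Lemma measurable_lt0 d (T : measurableType d) (R : realType) (f : T -> R) :
  measurable_fun setT f -> measurable [set t | f t < 0].
Proof.
move=> mf; rewrite (_ : [set t | _] = [set t | 0 < - f t]).
  exact/measurable_gt0/measurable_funN.
by apply/seteqP; split => t /=; rewrite oppr_gt0.
Qed.

Lemma measurable_sign_ne d (T : measurableType d) (R : realType) (f g : T -> R) :
  measurable_fun setT f -> measurable_fun setT g ->
  measurable [set t | (0 < f t) != (0 < g t)].
Proof.
move=> mf mg.
rewrite (_ : [set t | _] = ([set t | 0 < f t] `\` [set t | 0 < g t]) `|`
                           ([set t | 0 < g t] `\` [set t | 0 < f t])).
  by apply: measurableU; apply: measurableD; exact: measurable_gt0.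
apply/seteqP; split => t /=.
  by case: (0 < f t); case: (0 < g t) => //= _; [left|right]; split.
by case=> -[]; case: (0 < f t); case: (0 < g t) => // _ /(_ isT).
Qed.

Lemma le_probability d (T : measurableType d) (R : realType)
    (P : probability T R) (A B : set T) :
  measurable A -> measurable B -> A `<=` B -> (P A <= P B)%E.
Proof. by move=> mA mB AB; apply: le_measure => //; exact: mem_set. Qed.

Section probability_bounds.
Context d (T : measurableType d) (R : realType) (P : probability T R).
Implicit Types A B C E : set T.

(** Subadditivity turns the cover into [1 <= 2 * P A]. In the application [A] and [B] are exchanged
    by a reflection and [C] is the null set that it fixes. *)
Lemma probability_cover_ge_half A B C :
  measurable A -> measurable B -> measurable C ->
  P A = P B -> P C = 0%E -> (forall t, [\/ A t, B t | C t]) ->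
  ((1 / 2)%:E <= P A)%E.
Proof.
move=> mA mB mC AB C0 ABC.
have : (P setT <= P A + P B + P C)%E.
  apply: (@le_trans _ _ (P (A `|` B `|` C))).
    apply: le_probability => //; first by do 2!apply: measurableU => //.
    by move=> t _; case: (ABC t) => ?; [left; left|left; right|right].
  apply: (@le_trans _ _ (P (A `|` B) + P C)%E).
    by apply: measureU2 => //; exact: measurableU.
  by apply: leeD2r; exact: measureU2.
have fA : P A \is a fin_num by exact: fin_num_measure.
rewrite C0 adde0 probability_setT -AB -(fineK fA) -EFinD !lee_fin => h.
by lra.
Qed.

Lemma probability_disjoint_le_third A B C :
  measurable A -> measurable B -> measurable C -> P B = P A -> P C = P A ->
  (forall t, A t -> B t -> False) -> (forall t, A t -> C t -> False) ->
  (forall t, B t -> C t -> False) -> (P A <= (1 / 3)%:E)%E.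
Proof.
move=> mA mB mC BA CA AB AC BC.
have : (P (A `|` B `|` C) <= 1)%E.
  by apply: probability_le1; do 2!apply: measurableU => //.
have -> : P (A `|` B `|` C) = (P A + P B + P C)%E.
  transitivity (P (A `|` B) + P C)%E.
    apply: measureU => //; first exact: measurableU.
    by apply/seteqP; split => // t [[At|Bt] Ct]; [exact: AC Ct|exact: BC Ct].
  congr (_ + _)%E; apply: measureU => //.
  by apply/seteqP; split => // t [At Bt]; exact: AB Bt.
have fA : P A \is a fin_num by exact: fin_num_measure.
by rewrite BA CA -(fineK fA) -!EFinD !lee_fin => h; lra.
Qed.

(** Strictness comes from [B], a piece of [E] of positive probability that [A] avoids up to the null
    set [C]. *)
Lemma probability_lt_gap A B C E :
  measurable A -> measurable B -> measurable C -> measurable E ->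
  P C = 0%E -> (0 < P B)%E -> (forall t, B t -> E t) ->
  (forall t, A t -> E t /\ ~ B t \/ C t) -> (P A < P E)%E.
Proof.
move=> mA mB mC mE C0 B0 BE AE.
have fB : P B \is a fin_num by exact: fin_num_measure.
have fE : P E \is a fin_num by exact: fin_num_measure.
apply: (@le_lt_trans _ _ (P (E `\` B))).
  apply: (@le_trans _ _ (P (E `\` B) + P C)%E).
    apply: (@le_trans _ _ (P (E `\` B `|` C))).
      apply: le_probability => //; apply: measurableU => //; exact: measurableD.
    by apply: measureU2 => //; exact: measurableD.
  by rewrite C0 adde0.
have -> : P (E `\` B) = (P E - P B)%E.
  rewrite -[in RHS](setIidr BE); apply: measureD => //.
  by rewrite -ge0_fin_numE.
by move: B0; rewrite -(fineK fB) -(fineK fE) -EFinB !lte_fin => B0; lra.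
Qed.

End probability_bounds.

(** * Product measures: exchange, reassociation and change of components *)

Section product_transport.
Context {R : realType} {d1 d2 d3 : measure_display}.
Context {T1 : measurableType d1} {T2 : measurableType d2} {T3 : measurableType d3}.
Variables (P1 : probability T1 R) (P2 : probability T2 R) (P3 : probability T3 R).
Local Open Scope ereal_scope.

(** The left-hand side is the product [P2 \x^ P1], which integrates in the opposite order;
    uniqueness of the product measure identifies it with [P2 \x P1]. *)
Lemma product_measure_swap (S : set (T2 * T1)) : measurable S ->
  (P1 \x P2) [set z | S (z.2, z.1)] = (P2 \x P1) S.
Proof.
move=> mS.
transitivity ((P2 \x^ P1) S); last first.
  by apply/esym/product_measure_unique => // A B mA mB; exact: product_measure2E.
by apply: eq_integral => x _; congr (P2 _).
Qed.

Lemma product_measure_assoc (S : set (T1 * (T2 * T3))) : measurable S ->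
  ((P1 \x P2) \x P3) [set z | S (z.1.1, (z.1.2, z.2))] = (P1 \x (P2 \x P3)) S.
Proof.
move=> mS.
have mS' : measurable [set z : T1 * T2 * T3 | S (z.1.1, (z.1.2, z.2))].
  have mf : measurable_fun setT
      (fun z : T1 * T2 * T3 => (z.1.1, (z.1.2, z.2)) : T1 * (T2 * T3)).
    apply: (measurable_fun_pair (f := fst \o fst) (g := fun z => (z.1.2, z.2))).
      exact: measurableT_comp.
    by apply: (measurable_fun_pair (f := snd \o fst)) => //; exact: measurableT_comp.
  exact: measurable_preimageT mf mS.
transitivity (\int[P1 \x P2]_z
    P3 (xsection [set z | S (z.1.1, (z.1.2, z.2))] z)); first by [].
rewrite (fubini_tonelli1 _ (measurable_fun_xsection P3 mS')); last by [].
apply: eq_integral => x _; apply: eq_integral => y _; congr (P3 _).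
by apply/seteqP; split => z; rewrite /xsection/= !inE/= inE.
Qed.

End product_transport.


Section transport.
Context {R : realType} {d1 d2 d2' du : measure_display}.
Context {T1 : measurableType d1} {T2 : measurableType d2}.
Context {T2' : measurableType d2'} {U : measurableType du}.
Variables (P1 : probability T1 R) (P2 : probability T2 R) (P2' : probability T2' R).
Variables (f : T2 -> U) (f' : T2' -> U).
Hypothesis ff' : forall B, measurable B -> P2 (f @^-1` B) = P2' (f' @^-1` B).
Local Open Scope ereal_scope.

(** Only the law of the second component enters: for each fixed first coordinate, [ff'] applies to
    the section of [S]. *)
Lemma product_measure_transport_snd (S : set (T1 * U)) : measurable S ->
  (P1 \x P2) [set z | S (z.1, f z.2)] = (P1 \x P2') [set z | S (z.1, f' z.2)].
Proof.
move=> mS; apply: eq_integral => x _.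
have := ff' (measurable_xsection x mS).
set A := f @^-1` _; set A' := f' @^-1` _ => AA'.
transitivity (P2 A).
  by congr (P2 _); apply/seteqP; split => y; rewrite /A /xsection/= !inE.
rewrite AA'.
by congr (P2' _); apply/seteqP; split => y; rewrite /A' /xsection/= !inE.
Qed.

Lemma product_measure_transport_fst (S : set (U * T1)) :
  measurable_fun setT f -> measurable_fun setT f' -> measurable S ->
  (P2 \x P1) [set z | S (f z.1, z.2)] = (P2' \x P1) [set z | S (f' z.1, z.2)].
Proof.
move=> mf mf' mS.
have mS' : measurable [set z : T1 * U | S (z.2, z.1)].
  have msw : measurable_fun setT (fun z : T1 * U => (z.2, z.1)).
    exact: (measurable_fun_pair measurable_snd measurable_fst).
  exact: measurable_preimageT msw mS.
have mpre d (V : measurableType d) (g : V -> U) : measurable_fun setT g ->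
    measurable [set z : V * T1 | S (g z.1, z.2)].
  move=> mg; have mgz : measurable_fun setT (fun z : V * T1 => (g z.1, z.2)).
    exact: (measurable_fun_pair (measurableT_comp mg measurable_fst) measurable_snd).
  exact: measurable_preimageT mgz mS.
rewrite -(product_measure_swap P1 P2 (mpre _ _ _ mf)).
rewrite -(product_measure_swap P1 P2' (mpre _ _ _ mf')).
exact: (product_measure_transport_snd mS').
Qed.

End transport.

(** * Normal laws *)

Section normal_law.
Context {R : realType}.
(* [R] and [measurableTypeR R] have the same measurable sets but different
   displays; [lebesgue_measure], hence [normal_prob], lives on the latter. *)
Local Notation RT := (measurableTypeR R).
Implicit Types (a b c s m : R) (A : set RT).
Local Notation mu := (@lebesgue_measure R).

Local Notation pdf m s := (EFin \o normal_pdf m s).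

Let pdf_ge0 m s x : (0 <= (pdf m s) x)%E.
Proof. by rewrite lee_fin normal_pdf_ge0. Qed.

Let measurable_pdf m s : measurable_fun (setT : set RT) (pdf m s).
Proof. by apply/measurable_EFinP; exact: measurable_normal_pdf. Qed.

Import HBNNSimple.

(** For indicators this is the definition of [normal_prob] by its density; linearity extends it to
    simple functions and monotone convergence to all nonnegative measurable ones. *)
Lemma ge0_integral_normal_prob m s (f : RT -> \bar R) :
  measurable_fun setT f -> (forall x, 0 <= f x)%E ->
  (\int[normal_prob m s]_x f x = \int[mu]_x (f x * (normal_pdf m s x)%:E))%E.
Proof.
move=> mf f0; pose g := nnsfun_approx measurableT mf.
have indicE' (A : set RT) : measurable A ->
    (\int[normal_prob m s]_x (\1_A x)%:E = \int[mu]_x ((\1_A x)%:E * (pdf m s) x))%E.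
  move=> mA; rewrite integral_indic// setIT -[LHS]/(normal_prob m s A).
  rewrite /normal_prob [LHS]integral_mkcond.
  apply: eq_integral => x _; rewrite patchE indicE.
  by case: ifPn => xA; rewrite ?mul1e ?mul0e.
have sfE (h : {nnsfun RT >-> R}) :
    (\int[normal_prob m s]_x (h x)%:E = \int[mu]_x ((h x)%:E * (pdf m s) x))%E.
  under [LHS]eq_integral do rewrite fimfunE -fsumEFin//.
  rewrite [LHS]ge0_integral_fsum//; last 2 first.
    - by move=> y; apply/measurable_EFinP; exact: measurable_funM.
    - by move=> y x _; rewrite EFinM nnfun_muleindic_ge0.
  under [RHS]eq_integral.
    move=> x _; rewrite fimfunE -fsumEFin// ge0_mule_fsuml; last first.
      by move=> y; rewrite EFinM nnfun_muleindic_ge0.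
    over.
  rewrite [RHS]ge0_integral_fsum//; last 2 first.
    - move=> y; apply: emeasurable_funM => //.
      by apply/measurable_EFinP; exact: measurable_funM.
    - by move=> y x _; rewrite mule_ge0// EFinM nnfun_muleindic_ge0.
  apply: eq_fsbigr => y _.
  (* A negative [y] is not a value of [h], so its preimage is empty; otherwise [y] is a nonnegative
     constant that can leave both integrals. *)
  have [y0|y0] := ltP y 0.
    have -> : h @^-1` [set y] = set0.
      apply/seteqP; split => // x /= hx.
      by have : 0 <= h x := fun_ge0 x; rewrite hx leNgt y0.
    rewrite !integral0_eq// => x _; by rewrite indic0 mulr0// ?mul0e.
  under eq_integral do rewrite EFinM.
  under [RHS]eq_integral do rewrite EFinM -muleA.
  rewrite !ge0_integralZl//; first by rewrite indicE'.
  - by apply: emeasurable_funM => //; exact/measurable_EFinP.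
  - by move=> x _; rewrite mule_ge0.
  - exact/measurable_EFinP.
transitivity (limn (fun n => \int[normal_prob m s]_x (g n x)%:E)%E).
  rewrite -monotone_convergence//.
  - by apply: eq_integral => x _; apply/esym/cvg_lim => //; exact: cvg_nnsfun_approx.
  - by move=> n; exact/measurable_EFinP.
  - by move=> n x _; rewrite lee_fin fun_ge0.
  - by move=> x _ i j ij; rewrite lee_fin; exact/lefP/nd_nnsfun_approx.
under eq_fun do rewrite sfE.
rewrite -monotone_convergence//.
- apply: eq_integral => x _; apply/cvg_lim => //.
  under eq_fun do rewrite muleC.
  rewrite muleC; apply: cvgeZl => //; exact: cvg_nnsfun_approx.
- by move=> n; apply: emeasurable_funM => //; exact/measurable_EFinP.
- by move=> n x _; rewrite mule_ge0// lee_fin fun_ge0.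
- move=> x _ i j ij; apply: lee_wpmul2r => //.
  by rewrite lee_fin; exact/lefP/nd_nnsfun_approx.
Qed.

Let affine a c : RT -> RT := fun v => a + c * v.

Let measurable_affine a c : measurable_fun setT (affine a c).
Proof. by apply: measurable_funD => //; exact: measurable_funM. Qed.

#[local] HB.instance Definition _ a c :=
  isMeasurableFun.Build _ _ _ _ (affine a c) (measurable_affine a c).

(** Lebesgue measure is determined by its values on half-open intervals, so only these are computed;
    a negative [c] reverses them and moves the closed end to the left. *)
Let mu_affine a c A : c != 0 -> measurable A ->
  (mu A = `|c|%:E * mu ((fun v => a + c * v)%R @^-1` A))%E.
Proof.
move=> c0 mA.
have nc : 0 <= `|c| by [].
apply: (@lebesgue_measure_unique _
  (mscale (NngNum nc) (pushforward mu (affine a c)))) => // _ [[x y]] _ <-.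
rewrite -[RHS]/(`|c|%:E * mu (affine a c @^-1` `]x, y]))%E.
rewrite lebesgue_measure_itv/= lte_fin.
have [cp|cn] := ltrP 0 c.
  have -> : affine a c @^-1` `]x, y]%classic = `](x - a) / c, (y - a) / c]%classic.
    apply/seteqP; split => v /=; rewrite /affine !in_itv/= ltr_pdivrMr// ler_pdivlMr//;
      by move=> /andP[? ?]; apply/andP; split; lra.
  rewrite lebesgue_measure_itv/= lte_fin ltr_pM2r ?invr_gt0// ltrD2r.
  case: ifPn => _; last by rewrite mule0.
  rewrite -!EFinB -EFinM gtr0_norm//; congr EFin; field; exact: c0.
have {}cn : c < 0 by rewrite lt_neqAle c0.
have -> : affine a c @^-1` `]x, y]%classic = `[(y - a) / c, (x - a) / c[%classic.
  apply/seteqP; split => v /=; rewrite /affine !in_itv/= ltr_ndivlMr// ler_ndivrMr//;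
    by move=> /andP[? ?]; apply/andP; split; lra.
rewrite lebesgue_measure_itv/= lte_fin ltr_nM2r ?invr_lt0// ltrD2r.
case: ifPn => _; last by rewrite mule0.
rewrite -!EFinB -EFinM ltr0_norm//; congr EFin; field; exact: c0.
Qed.

(** Change of variables in the density. The absolute value lets [c] be negative, so that reflections
    are covered too. *)
Lemma normal_prob_affine a c A : c != 0 -> measurable A ->
  normal_prob 0 1 ((fun v => a + c * v) @^-1` A) = normal_prob a `|c| A.
Proof.
move=> c0 mA.
have nc : 0 <= `|c| by [].
rewrite [RHS]/normal_prob integral_mkcond.
rewrite [RHS](eq_measure_integral
  (mscale (NngNum nc) (pushforward mu (affine a c)))); last first.
  by move=> B mB _; exact: mu_affine.
have mA' : measurable_fun setT (pdf a `|c| \_ A).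
  by apply/(measurable_restrictT _ _).1 => //; exact: measurable_funTS.
have pA x : (0 <= (pdf a `|c| \_ A) x)%E.
  by rewrite patchE; case: ifP.
rewrite ge0_integral_mscale//.
rewrite ge0_integral_pushforward//.
rewrite preimage_setT -ge0_integralZl//; last 2 first.
  exact: (measurableT_comp mA' (measurable_affine a c)).
  by move=> ? _; exact: pA.
rewrite [LHS]/normal_prob [LHS]integral_mkcond; apply: eq_integral => x _.
rewrite !patchE/= patchE /=.
have -> : (x \in (fun v => a + c * v) @^-1` A) = (a + c * x \in A).
  by apply/idP/idP; rewrite !inE.
case: ifPn => _; last by rewrite mule0.
rewrite /= -EFinM; congr EFin.
rewrite !normal_pdfE ?oner_eq0 ?normr_eq0//= /normal_peak /normal_fun.
rewrite real_normK ?num_real// expr1n mul1r -!mulrnAr sqrtrM ?sqr_ge0// sqrtr_sqr.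
rewrite invfM mulrA mulrA divff ?normr_eq0// mul1r; congr (_ * expR _).
rewrite subr0.
have E (z : R) : - z ^+ 2 / 2 = - (a + c * z - a) ^+ 2 / (c * (c *+ 2)) by field.
exact: E.
Qed.

End normal_law.

Section normal_positivity.
Context {R : realType}.
Local Notation RT := (measurableTypeR R).
Local Notation N := (@normal_prob R 0 1).

Lemma normal_prob_set1 (m s a : R) : normal_prob m s [set a] = 0%E.
Proof.
have /null_content_dominatesP := @normal_prob_dominates R m s.
by apply => //; exact: lebesgue_measure_set1.
Qed.

Lemma normal_prob_itvoo_gt0 (a b : R) : a < b -> (0 < N `]a, b[%classic)%E.
Proof.
move=> ab.
have sq_le (x : R) : a < x -> x < b -> x ^+ 2 <= a ^+ 2 + b ^+ 2.
  by move=> ax xb; have [x0|x0] := lerP 0 x; nra.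
(* By [sq_le], the density is at least this constant on the whole interval. *)
pose k : R := normal_peak 1 * expR (- (a ^+ 2 + b ^+ 2) / 2).
have k0 : 0 < k by rewrite mulr_gt0 ?expR_gt0// normal_peak_gt0 ?oner_eq0.
apply: (@lt_le_trans _ _ (\int[lebesgue_measure]_(x in `]a, b[) k%:E)%E).
  rewrite integral_cst//= lebesgue_measure_itv/= lte_fin ab -EFinB -EFinM.
  by rewrite lte_fin mulr_gt0// subr_gt0.
apply: ge0_le_integral => //=.
- by move=> x _; rewrite lee_fin ltW.
- apply: measurable_funTS; apply/measurable_EFinP; exact: measurable_normal_pdf.
- move=> x; rewrite /= in_itv/= => /andP[ax xb].
  rewrite lee_fin normal_pdfE ?oner_eq0//= ler_pM2l ?normal_peak_gt0 ?oner_eq0//.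
  rewrite ler_expR subr0 expr1n ler_pM2r ?invr_gt0// lerN2.
  exact: sq_le.
Qed.

End normal_positivity.

(** * The second moment of the standard normal law *)

Section normal_second_moment.
Context {R : realType}.
Local Notation RT := (measurableTypeR R).
Local Notation N := (@normal_prob R 0 1).

Let sqr (x : RT) : \bar R := (x ^+ 2)%:E.

Let measurable_sqr : measurable_fun (setT : set RT) sqr.
Proof. by apply/measurable_EFinP; exact: measurable_funX. Qed.

Let sqr_ge0e x : (0 <= sqr x)%E. Proof. by rewrite lee_fin sqr_ge0. Qed.

(* Integrating [1 + u <= expR u] at [u = (1 - s ^+ 2) * x ^+ 2 / 2] against the
   standard normal law gives [1 + (1 - s ^+ 2) * M / 2 <= s^-1] for the second
   moment [M]; letting [s] tend to 1 from both sides forces [M = 1]. *)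
Let density_ratio (s x : R) : 0 < s ->
  (1 + (1 - s ^+ 2) / 2 * x ^+ 2) * normal_pdf 0 1 x <= s^-1 * normal_pdf 0 s^-1 x.
Proof.
move=> s0; rewrite !normal_pdfE ?oner_eq0 ?invr_eq0 ?gt_eqF//.
have -> : normal_peak s^-1 = s * normal_peak 1.
  rewrite /normal_peak expr1n mul1r -mulrnAr sqrtrM ?sqr_ge0// sqrtr_sqr.
  by rewrite gtr0_norm ?invr_gt0// invfM invrK.
have -> : s^-1 * (s * normal_peak 1 * normal_fun 0 s^-1 x) =
    normal_peak 1 * normal_fun 0 s^-1 x by field; rewrite gt_eqF.
rewrite mulrCA ler_pM2l ?normal_peak_gt0 ?oner_eq0//.
rewrite /normal_fun.
have -> : - (x - 0) ^+ 2 / (s^-1 ^+ 2 *+ 2) =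
    (1 - s ^+ 2) / 2 * x ^+ 2 + - (x - 0) ^+ 2 / (1 ^+ 2 *+ 2).
  by field; rewrite gt_eqF.
by rewrite expRD ler_pM2r ?expR_gt0// expR_ge1Dx.
Qed.

Let M := (\int[N]_x sqr x)%E.

Let density_int (s : R) : 0 < s ->
  (\int[lebesgue_measure]_x (s^-1 * normal_pdf 0 s^-1 x)%:E = (s^-1)%:E)%E.
Proof.
move=> s0; under eq_integral do rewrite EFinM.
rewrite ge0_integralZl//.
- by rewrite integral_normal_pdf mule1.
- by apply/measurable_EFinP; exact: measurable_normal_pdf.
- by move=> x _; rewrite lee_fin normal_pdf_ge0.
- by rewrite lee_fin invr_ge0 ltW.
Qed.

(** For [s < 1] the coefficient of [M] is positive, so integrating [density_ratio] bounds [M] from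
    above. *)
Let upper (s : R) : 0 < s < 1 -> (1 + ((1 - s ^+ 2) / 2)%:E * M <= (s^-1)%:E)%E.
Proof.
move=> /andP[s0 s1]; have k0 : 0 <= (1 - s ^+ 2) / 2 by nra.
rewrite -(density_int s0).
have -> : (1 + ((1 - s ^+ 2) / 2)%:E * M =
    \int[N]_x (1 + ((1 - s ^+ 2) / 2)%:E * sqr x))%E.
  rewrite ge0_integralD//; last 2 first.
  - by move=> x _; rewrite mule_ge0.
  - by apply: emeasurable_funM.
  congr (_ + _)%E; last by rewrite ge0_integralZl.
  by rewrite integral_cst// mul1e; exact/esym/probability_setT.
rewrite ge0_integral_normal_prob; last 2 first.
- by apply: emeasurable_funD => //; apply: emeasurable_funM.
- by move=> x; rewrite adde_ge0// mule_ge0.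
apply: ge0_le_integral => //.
- move=> x _; apply: mule_ge0; last by rewrite lee_fin normal_pdf_ge0.
  by apply: adde_ge0 => //; exact: mule_ge0.
- apply: emeasurable_funM.
    by apply: emeasurable_funD => //; apply: emeasurable_funM.
  by apply/measurable_EFinP; exact: measurable_normal_pdf.
- by apply/measurable_EFinP; apply: measurable_funM => //; exact: measurable_normal_pdf.
- move=> x _; have := @density_ratio s x s0.
  by rewrite -lee_fin EFinM EFinD EFinM.
Qed.

(** For [s > 1] the coefficient of [M] in [density_ratio] is negative. Its term is moved to the
    other side, so that only nonnegative functions are integrated and [M] is bounded from below. *)
Let lower (s : R) : 1 < s -> (1 <= (s^-1)%:E + ((s ^+ 2 - 1) / 2)%:E * M)%E.
Proof.
move=> s1; have k0 : 0 <= (s ^+ 2 - 1) / 2 by nra.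
have s0 : 0 < s by lra.
have alg (x y : R) : y - (s ^+ 2 - 1) / 2 * x ^+ 2 * y =
    (1 + (1 - s ^+ 2) / 2 * x ^+ 2) * y by field.
rewrite -(density_int s0) -(integral_normal_pdf 0 1) /M -ge0_integralZl//.
rewrite ge0_integral_normal_prob; last 2 first.
- by apply: emeasurable_funM.
- by move=> x; rewrite mule_ge0.
have pdf_ge0 (m t x : R) : (0 <= (normal_pdf m t x)%:E)%E.
  by rewrite lee_fin normal_pdf_ge0.
have mpdf (m t : R) : measurable_fun (setT : set RT) (fun x => (normal_pdf m t x)%:E).
  by apply/measurable_EFinP; exact: measurable_normal_pdf.
have s'0 : 0 <= s^-1 by rewrite invr_ge0 ltW.
rewrite -ge0_integralD//; last 4 first.
- by move=> x _; rewrite lee_fin mulr_ge0// normal_pdf_ge0.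
- by apply/measurable_EFinP; apply: measurable_funM => //; exact: measurable_normal_pdf.
- by move=> x _; rewrite !mule_ge0.
- by apply: emeasurable_funM => //; exact: emeasurable_funM.
apply: ge0_le_integral => //.
- apply: emeasurable_funD.
    by apply/measurable_EFinP; apply: measurable_funM => //; exact: measurable_normal_pdf.
  by apply: emeasurable_funM => //; exact: emeasurable_funM.
- move=> x _; rewrite /sqr -!EFinM -EFinD lee_fin -lerBlDr.
  by rewrite alg; exact: density_ratio.
Qed.

Lemma integral_normal_sqr : (\int[N]_x (x ^+ 2)%:E = 1)%E.
Proof.
have M0 : (0 <= M)%E by apply: integral_ge0 => x _.
rewrite -/sqr -/M.
(* An infinite [M] would contradict [upper] at [s = 1 / 2]. *)
have Mfin : M \is a fin_num.
  rewrite ge0_fin_numE//; have h : 0 < (1 / 2 : R) < 1 by lra.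
  rewrite ltey; apply/eqP => Moo; have := upper h.
  by rewrite Moo gt0_muley ?lte_fin; [rewrite addey// leye_eq|lra].
move: M0 upper lower; rewrite -(fineK Mfin); move: (fine M) => m.
rewrite lee_fin => m0 up lo; congr EFin; apply/eqP; rewrite eq_le; apply/andP; split.
  rewrite leNgt; apply/negP => m1.
  (* At [s = 1 - e], [upper] reads [m * (1 - e) * (2 - e) / 2 <= 1], that is
     [m - 3 * m * e / 2 + m * e ^+ 2 / 2 <= 1]. This [e] makes [3 * m * e / 2] only half of the
     excess [m - 1], a contradiction. *)
  pose e := (m - 1) / (3 * m).
  have e0 : 0 < e by rewrite divr_gt0//; lra.
  have me : m * e = (m - 1) / 3 by rewrite /e; field; rewrite gt_eqF//; lra.
  have e1 : e < 1 / 3 by nra.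
  have s01 : 0 < 1 - e < 1 by lra.
  have := up _ s01; rewrite -EFinM -EFinD lee_fin -[leRHS]mul1r ler_pdivlMr; last by lra.
  have -> : (1 + (1 - (1 - e) ^+ 2) / 2 * m) * (1 - e) =
      1 - e * (1 - (1 - e) * (2 - e) / 2 * m) by field.
  rewrite gerBl pmulr_rge0// => h.
  have := mulr_ge0 m0 (sqr_ge0 e); nra.
rewrite leNgt; apply/negP => m1.
(* At [s = 1 + e], [lower] reads [1 <= m * (1 + e) * (2 + e) / 2]; for this [e] the right-hand side
   exceeds [m] by less than [1 - m]. *)
pose e := (1 - m) / 4.
have e0 : 0 < e by rewrite divr_gt0//; lra.
have s1 : 1 < 1 + e by lra.
have := lo _ s1; rewrite -EFinM -EFinD lee_fin.
rewrite -(ler_pM2r (_ : 0 < 1 + e)); last by lra.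
have -> : ((1 + e)^-1 + ((1 + e) ^+ 2 - 1) / 2 * m) * (1 + e) =
   1 + e * ((1 + e) * (2 + e) / 2 * m) by field; rewrite gt_eqF//; lra.
rewrite mul1r lerD2l -[leLHS]mulr1 ler_pM2l// => h.
rewrite /e in h; nra.
Qed.

End normal_second_moment.

(** * Mean and variance of a variable with standard normal law *)

Section normal_moments.
Context d (T : measurableType d) (R : realType) (P : probability T R).
Local Notation RT := (measurableTypeR R).
Local Notation N := (@normal_prob R 0 1).

Let integral_law (X : T -> RT) (f : RT -> \bar R) :
  measurable_fun setT X ->
  (forall A, measurable A -> P (X @^-1` A) = N A) ->
  measurable_fun setT f -> (forall x, 0 <= f x)%E ->
  (\int[P]_t f (X t) = \int[N]_x f x)%E.
Proof.
move=> mX XN mf f0.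
pose X' : {mfun T >-> RT} := mfun_Sub (mem_set mX).
transitivity (\int[pushforward P X']_x f x)%E.
  by rewrite ge0_integral_pushforward.
by apply: eq_measure_integral => A mA _; exact: XN.
Qed.

Context (X : {RV P >-> R}).
Hypothesis XN : forall A : set R, measurable A -> P (X @^-1` A) = N A.

Lemma normal_law_Lfun2 : (X : T -> R) \in Lfun P 2%:E.
Proof.
have mX : measurable_fun setT (X : T -> RT) by exact: (measurable_funPT X).
rewrite inE; apply/andP; split; rewrite inE//=.
rewrite /finite_norm unlock /Lnorm poweR_lty//.
rewrite (_ : (\int[P]_x _)%E = 1%E) ?ltry//.
rewrite -(@integral_normal_sqr R).
rewrite -(integral_law mX XN (f := fun x => (x ^+ 2)%:E)).
- by apply: eq_integral => t _; rewrite /= powR_mulrn// -normrX ger0_norm// sqr_ge0.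
- by apply/measurable_EFinP; exact: measurable_funX.
- by move=> x; rewrite lee_fin sqr_ge0.
Qed.

Lemma normal_law_Lfun1 : (X : T -> R) \in Lfun P 1.
Proof. by apply: Lfun_subset12 normal_law_Lfun2; exact: fin_num_measure. Qed.

(** [X] and [- X] have the same law, so the expectation equals its own opposite; it is finite
    because the second moment is. *)
Lemma normal_law_expectation : ('E_P[X] = 0)%E.
Proof.
have X1 := normal_law_Lfun1.
pose Y : {RV P >-> R} := (- X)%R.
have NY A : measurable A -> P (Y @^-1` A) = N A.
  move=> mA; have mA' : measurable ((fun v : R => 0 + -1 * v) @^-1` A).
    have mf : measurable_fun setT (fun v : R => 0 + -1 * v).
      by apply: measurable_funD => //; exact: measurable_funM.
    exact: measurable_preimageT mf mA.
  transitivity (P (X @^-1` ((fun v : R => 0 + -1 * v) @^-1` A))).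
    by congr (P _); apply/seteqP; split => t; rewrite /= mulN1r add0r.
  transitivity (N ((fun v : R => 0 + -1 * v) @^-1` A)); first exact: XN.
  have n1 : (-1 : R) != 0 by rewrite oppr_eq0 oner_eq0.
  by have := normal_prob_affine 0 n1 mA; rewrite normrN normr1.
have iX : P.-integrable setT (EFin \o X) by exact/Lfun1_integrable.
have Y1 : (Y : T -> R) \in Lfun P 1 by rewrite /Y/= rpredN.
have iY : P.-integrable setT (EFin \o Y) by exact/Lfun1_integrable.
have EXY : ('E_P[X] = 'E_P[Y])%E.
  have mE : measurable_fun (setT : set R) (@EFin R) by exact/measurable_EFinP.
  rewrite unlock -(integral_distribution (X := X) mE iX).
  rewrite -(integral_distribution (X := Y) mE iY).
  by apply: eq_measure_integral => A mA _; exact: etrans (XN mA) (esym (NY A mA)).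
have EY : ('E_P[Y] = - 'E_P[X])%E.
  rewrite (_ : (Y : T -> R) = (-1) \o* X)%R ?expectationZl// ?EFinN ?mulN1e//.
  by apply/funext => t; rewrite /= mulrN1.
have := expectation_fin_num X1; move: EXY; rewrite EY.
case: ('E_P[X])%E => // r [] h _; congr EFin; lra.
Qed.

Lemma normal_law_variance : ('V_P[X] = 1)%E.
Proof.
have mX : measurable_fun setT (X : T -> RT) by exact: (measurable_funPT X).
rewrite varianceE ?normal_law_Lfun2// normal_law_expectation expe2 mul0e sube0.
rewrite -(@integral_normal_sqr R) unlock.
rewrite -(integral_law mX XN (f := fun x => (x ^+ 2)%:E))//.
- by apply/measurable_EFinP; exact: measurable_funX.
- by move=> x; rewrite lee_fin sqr_ge0.
Qed.

End normal_moments.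

(** * Pairs of independent normals *)

Section normal_pair.
Context {R : realType}.
Local Notation RT := (measurableTypeR R).
Implicit Types (c s : R) (S : set (RT * RT)).
Local Notation mu := (@lebesgue_measure R).
Local Notation N := (@normal_prob R 0 1).

(** For [c != 0] and [c ^+ 2 + s ^+ 2 = 1] this is the joint density of a standard Gaussian pair of
    covariance [s]. Its symmetry in [x] and [v] is what makes the two pairs of
    [normal_pair_rotation] equal in law. *)
Let g c s (x v : R) : R := normal_peak c * normal_peak 1 *
  expR (- (x ^+ 2 + v ^+ 2 - 2 * s * x * v) / (c ^+ 2 *+ 2)).

Let g_ge0 c s x v : 0 <= g c s x v.
Proof. by rewrite !mulr_ge0 ?expR_ge0 ?normal_peak_ge0. Qed.

Let g_sym c s x v : g c s x v = g c s v x.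
Proof. by rewrite /g (addrC (x ^+ 2)) (mulrAC _ x v). Qed.

Let measurable_g c s : measurable_fun (setT : set (RT * RT))
  (fun z : RT * RT => g c s z.1 z.2).
Proof.
apply: measurable_funM => //; apply: measurableT_comp => //.
apply: measurable_funM => //; apply: measurableT_comp => //.
apply: measurable_funB.
  by apply: measurable_funD; apply: measurable_funX.
apply: measurable_funM => //.
by apply: measurable_funM.
Qed.

Let g_density c s x v : c != 0 -> c ^+ 2 + s ^+ 2 = 1 ->
  normal_pdf (s * v) `|c| x * normal_pdf 0 1 v = g c s x v.
Proof.
move=> c0 cs; rewrite !normal_pdfE ?oner_eq0 ?normr_eq0//.
rewrite mulrACA; congr (_ * _).
  by rewrite /normal_peak real_normK ?num_real.
rewrite /normal_fun -expRD; congr expR.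
rewrite real_normK ?num_real//.
(* Spreading [v ^+ 2] over [c ^+ 2 + s ^+ 2] completes the square; what remains is an identity in
   free [c] and [s]. *)
have E : v ^+ 2 = v ^+ 2 * (c ^+ 2 + s ^+ 2) by rewrite cs mulr1.
rewrite [v ^+ 2 in RHS]E; clear -c0.
by field.
Qed.

Let integral_conditional c s (B : RT -> set RT) : c != 0 -> c ^+ 2 + s ^+ 2 = 1 ->
  (forall v, measurable (B v)) ->
  measurable_fun (setT : set RT) (fun v => normal_prob (s * v) `|c| (B v)) ->
  (\int[N]_v normal_prob (s * v) `|c| (B v) =
   \int[mu]_v \int[mu]_x (\1_(B v) x * g c s x v)%:E)%E.
Proof.
move=> c0 cs mB mN; rewrite ge0_integral_normal_prob//.
apply: eq_integral => v _.
rewrite /normal_prob integral_mkcond -ge0_integralZr//.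
- apply: eq_integral => x _; rewrite patchE indicE.
  by case: ifPn => _; rewrite ?mul0e ?mul0r// mul1r -EFinM g_density.
- apply/(measurable_restrictT _ _).1 => //; apply: measurable_funTS.
  by apply/measurable_EFinP; exact: measurable_normal_pdf.
- by move=> x _; rewrite patchE; case: ifP => _ //; rewrite lee_fin normal_pdf_ge0.
- by rewrite lee_fin normal_pdf_ge0.
Qed.

(* Both pairs have the same joint density, that of a standard Gaussian pair of
   covariance [s]; the choice [c' = - c] adds a reflection. *)
Lemma normal_pair_rotation c c' s S :
  c != 0 -> c ^+ 2 + s ^+ 2 = 1 -> c' ^+ 2 = c ^+ 2 -> measurable S ->
  (N \x N)%E [set z | S (c * z.1 + s * z.2, z.2)] =
  (N \x N)%E [set z | S (z.1, s * z.1 + c' * z.2)].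
Proof.
move=> c0 cs cc mS.
have c'0 : c' != 0 by rewrite -sqrf_eq0 cc sqrf_eq0.
have norm_c' : `|c'| = `|c|.
  by apply/eqP; rewrite -(@eqrXn2 _ 2)// !real_normK ?num_real// cc.
have mlin a b : measurable_fun (setT : set (RT * RT))
    (fun z : RT * RT => a * z.1 + b * z.2).
  by apply: measurable_funD; exact: measurable_funM.
have mf1 : measurable_fun setT
    (fun z : RT * RT => (c * z.1 + s * z.2, z.2) : RT * RT).
  exact: (measurable_fun_pair (mlin c s)).
have mf2 : measurable_fun setT
    (fun z : RT * RT => (z.1, s * z.1 + c' * z.2) : RT * RT).
  exact: (measurable_fun_pair _ (mlin s c')).
have mS1 : measurable [set z : RT * RT | S (c * z.1 + s * z.2, z.2)].
  exact: measurable_preimageT mf1 mS.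
have mS2 : measurable [set z : RT * RT | S (z.1, s * z.1 + c' * z.2)].
  exact: measurable_preimageT mf2 mS.
have E1 v : N (ysection [set z | S (c * z.1 + s * z.2, z.2)] v) =
    normal_prob (s * v) `|c| (ysection S v).
  rewrite -normal_prob_affine//; last exact: measurable_ysection.
  by congr (N _); apply/seteqP; split => u;
    rewrite /ysection/= !inE /= addrC.
have E2 u : N (xsection [set z | S (z.1, s * z.1 + c' * z.2)] u) =
    normal_prob (s * u) `|c| (xsection S u).
  rewrite -norm_c' -normal_prob_affine//; last exact: measurable_xsection.
(* Each pair is conditioned on its coordinate that is left unchanged: given the value [v] of that
   one, the other is normal with mean [s * v] and deviation [|c|]. *)
transitivity (\int[N]_v normal_prob (s * v) `|c| (ysection S v))%E.
  transitivity ((N \x^ N)%E [set z | S (c * z.1 + s * z.2, z.2)]).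
    by apply: product_measure_unique => // A B mA mB; exact: product_measure2E.
  by apply: eq_integral => v _; exact: E1.
transitivity (\int[N]_u normal_prob (s * u) `|c| (xsection S u))%E; last first.
  by apply: eq_integral => v _; exact/esym/E2.
have mz : measurable_fun setT (fun z : RT * RT => (\1_S z * g c s z.1 z.2)%:E).
  by apply/measurable_EFinP; apply: measurable_funM => //; exact: measurable_indic.
transitivity (\int[mu]_v \int[mu]_u (\1_S (u, v) * g c s u v)%:E)%E.
  have mN : measurable_fun (setT : set RT)
      (fun v => normal_prob (s * v) `|c| (ysection S v)).
    by under eq_fun do rewrite -E1; exact: measurable_fun_ysection.
  rewrite (integral_conditional c0 cs (fun v => measurable_ysection v mS) mN).
  apply: eq_integral => v _; apply: eq_integral => u _.
  by rewrite !indicE mem_ysection.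
(* Tonelli exchanges the integrals; [g_sym] then matches the density with the conditioning of the
   other pair. *)
transitivity (\int[mu]_u \int[mu]_v (\1_S (u, v) * g c s u v)%:E)%E.
  apply/esym/(fubini_tonelli (fun z : RT * RT => (\1_S z * g c s z.1 z.2)%:E)) => //.
  by move=> z; rewrite lee_fin mulr_ge0.
have mN : measurable_fun (setT : set RT)
    (fun u => normal_prob (s * u) `|c| (xsection S u)).
  by under eq_fun do rewrite -E2; exact: measurable_fun_xsection.
rewrite (integral_conditional c0 cs (fun u => measurable_xsection u mS) mN).
apply: eq_integral => u _; apply: eq_integral => v _.
by rewrite !indicE mem_xsection g_sym.
Qed.

End normal_pair.

(** * Sign disagreements in a standard Gaussian pair *)

Section normal_pair_signs.
Context {R : realType}.
Local Notation RT := (measurableTypeR R).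
Local Notation N := (@normal_prob R 0 1).
Local Notation NN := (N \x N)%E.

Let measurable_lin (a b : R) :
  measurable_fun (setT : set (RT * RT)) (fun z => a * z.1 + b * z.2 : R).
Proof. by apply: measurable_funD; exact: measurable_funM. Qed.

Let null_snd0 : NN (setT `*` [set 0%R]) = 0%E.
Proof.
transitivity (N setT * N [set 0%R])%E; first exact: product_measure1E.
by rewrite normal_prob_set1 mule0.
Qed.

Let null_fst0 : NN ([set 0] `*` setT) = 0%E.
Proof.
transitivity (N [set 0%R] * N setT)%E; first exact: product_measure1E.
by rewrite normal_prob_set1 mul0e.
Qed.

(** Reflecting the second coordinate, which is the rotation lemma with [c = 1], [c' = -1] and
    [s = 0], preserves the law and exchanges agreement and disagreement of signs, except where that
    coordinate vanishes. *)
Lemma normal_pair_sign_ne_ge :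
  ((1 / 2)%:E <= NN [set z : RT * RT | ((0 < z.1) != (0 < z.2))%R])%E.
Proof.
set S := [set z : RT * RT | _].
pose S' := [set z : RT * RT | (0 < z.1) != (0 < - z.2)].
have mS : measurable S by exact: measurable_sign_ne.
have mS' : measurable S'.
  by apply: measurable_sign_ne => //; exact: measurable_funN.
have SS' : NN S = NN S'.
  have := @normal_pair_rotation R 1 (-1) 0 S.
  rewrite oner_eq0 sqrrN expr1n expr0n addr0 => /(_ isT erefl erefl mS).
  have -> : [set z : RT * RT | S (1 * z.1 + 0 * z.2, z.2)] = S.
    by apply/seteqP; split => z; rewrite /S/= mul1r mul0r addr0.
  have -> : [set z : RT * RT | S (z.1, 0 * z.1 + -1 * z.2)] = S'.
    by apply/seteqP; split => z; rewrite /S/= mulN1r mul0r add0r.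
  by [].
have mZ : measurable (setT `*` [set 0] : set (RT * RT)) by exact: measurableX.
apply: (probability_cover_ge_half mS mS' mZ SS' null_snd0) => -[u v].
rewrite /S /S' /= oppr_gt0.
case: (ltrgtP 0 v) => v0; case: (0 < u) => /=.
- exact: Or32.
- exact: Or31.
- exact: Or31.
- exact: Or32.
- by apply: Or33; split.
- by apply: Or33; split.
Qed.

(* The directions at 0, 60 and 120 degrees: a sign change occurs along exactly
   one of the three 60 degree steps from the first direction to its opposite. *)
Lemma normal_pair_sixty_degrees (c s : R) : s = 1 / 2 -> c ^+ 2 = 3 / 4 ->
  (NN [set z : RT * RT | (z.1 * (s * z.1 + c * z.2) < 0)%R] <= (1 / 3)%:E)%E.
Proof.
move=> sE c2; have c0 : c != 0 by apply/eqP => c0; move: c2; rewrite c0; lra.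
have cs : c ^+ 2 + s ^+ 2 = 1 by rewrite c2 sE; field.
(* Let [x] and [y] be the two components after [rot], 60 degrees apart. The successive directions
   are [y], [x], [x - y], [- y], and [S1], [S2], [S3] are the sign changes along the three steps. *)
pose S1 := [set z : RT * RT | z.1 * z.2 < 0].
pose S2 := [set z : RT * RT | z.1 * (z.1 - z.2) < 0].
pose S3 := [set z : RT * RT | z.2 * (z.2 - z.1) < 0].
have mfst : measurable_fun (setT : set (RT * RT)) (fun z : RT * RT => z.1 : R).
  exact: measurable_fst.
have msnd : measurable_fun (setT : set (RT * RT)) (fun z : RT * RT => z.2 : R).
  exact: measurable_snd.
have mS1 : measurable S1.
  by apply: measurable_lt0; apply: measurable_funM.
have mS2 : measurable S2.
  by apply: measurable_lt0; apply: measurable_funM => //; exact: measurable_funB.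
have mS3 : measurable S3.
  by apply: measurable_lt0; apply: measurable_funM => //; exact: measurable_funB.
have S12 (x y : R) : x * y < 0 -> x * (x - y) < 0 -> False by nra.
have S13 (x y : R) : x * y < 0 -> y * (y - x) < 0 -> False by nra.
have S23 (x y : R) : x * (x - y) < 0 -> y * (y - x) < 0 -> False by nra.
pose rot (S : set (RT * RT)) := [set z : RT * RT | S (c * z.1 + s * z.2, z.2)].
have mrot S : measurable S -> measurable (rot S).
  have mf : measurable_fun setT
      (fun z : RT * RT => (c * z.1 + s * z.2, z.2) : RT * RT).
    exact: (measurable_fun_pair (measurable_lin c s)).
  exact: measurable_preimageT mf.
(* All three rotated events are compared with [D (- c)]; the free sign in the rotation lemma also
   gives [rot S1] the probability of [D c], the event of the statement. *)
pose D b := [set z : RT * RT | z.1 * (s * z.1 + b * z.2) < 0].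
have mD b : measurable (D b).
  by apply: measurable_lt0; apply: measurable_funM.
have rot1 b : b ^+ 2 = c ^+ 2 -> NN (rot S1) = NN (D b).
  by move=> bc; exact: (normal_pair_rotation c0 cs bc mS1).
have rot2 : NN (rot S2) = NN (D (- c)).
  rewrite (normal_pair_rotation c0 cs erefl mS2); congr (NN _).
  apply/seteqP; split => z; rewrite /S2 /D/=;
    by rewrite (_ : z.1 - _ = s * z.1 + - c * z.2)// sE; field.
have lin3 (x y : R) : x - (c * y + s * x) = s * x + - c * y by rewrite sE; field.
have rot3 : NN (rot S3) = NN (D (- c)).
  transitivity (NN [set z : RT * RT | rot S3 (z.2, z.1)]).
    apply/esym/(@product_measure_swap R _ _ _ _ N N); exact: mrot.
  congr (NN _); apply/funext => z.
  by apply: (congr1 (fun a => is_true (z.1 * a < 0))); exact: lin3.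
have rot1' : NN (rot S1) = NN (D (- c)) by apply: rot1; rewrite sqrrN.
rewrite -/(D c) -(rot1 c erefl).
apply: (probability_disjoint_le_third (mrot _ mS1) (mrot _ mS2) (mrot _ mS3)
  (etrans rot2 (esym rot1')) (etrans rot3 (esym rot1'))).
- move=> z; rewrite /rot /S1 /S2 /=.
  by move: (_ + _) => x; move: z.2 => y; exact: S12.
- move=> z; rewrite /rot /S1 /S3 /=.
  by move: (_ + _) => x; move: z.2 => y; exact: S13.
- move=> z; rewrite /rot /S2 /S3 /=.
  by move: (_ + _) => x; move: z.2 => y; exact: S23.
Qed.

(** As [r > 1 / 2], the second direction makes an angle below 60 degrees with the first. The
    disagreement event is thus, up to a null set, a narrower double wedge inside that of
    [normal_pair_sixty_degrees]. *)
Lemma normal_pair_sign_ne_lt (r t : R) : 1 / 2 < r -> 0 < t ->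
  r ^+ 2 + t ^+ 2 = 1 ->
  (NN [set z : RT * RT | ((0 < z.1) != (0 < r * z.1 + t * z.2))%R] < (1 / 3)%:E)%E.
Proof.
move=> r2 t0 rt.
pose s : R := 1 / 2; pose c : R := Num.sqrt (3 / 4).
have s0 : 0 < s by rewrite /s; lra.
have c0 : 0 < c by rewrite sqrtr_gt0; lra.
have c2 : c ^+ 2 = 3 / 4 by rewrite sqr_sqrtr//; lra.
pose k := r / t.
have rE : r = k * t by rewrite /k divfK// gt_eqF.
have k0 : 0 < k by rewrite divr_gt0//; lra.
have sk : s < k * c.
  have : (s * t) ^+ 2 < (r * c) ^+ 2.
    rewrite !exprMn c2 /s (_ : t ^+ 2 = 1 - r ^+ 2); last by lra.
    by nra.
  rewrite ltr_sqr ?nnegrE ?mulr_ge0 ?ltW//; last by lra.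
  by rewrite rE (mulrAC k t c) ltr_pM2r.
(* For [u > 0] the narrow wedge is [v <= - k * u] and the wide one [v < - (s / c) * u]. The slope
   [m] is the midpoint, and [b] satisfies [m = (s / c) * b], so the box [B] fits between the two
   boundary lines. *)
pose m := (s / c + k) / 2.
have sc : s / c < k by rewrite ltr_pdivrMr.
have mk : m < k by rewrite /m; lra.
have sm : s < m * c by rewrite -ltr_pdivrMr// /m; lra.
pose b := m * c / s.
have b1 : 1 < b by rewrite /b ltr_pdivlMr// mul1r.
have mc : m * c = s * b by rewrite /b [RHS]mulrC divfK// gt_eqF.
pose E := [set z : RT * RT | z.1 * (s * z.1 + c * z.2) < 0].
apply: (@lt_le_trans _ _ (NN E)); last exact: normal_pair_sixty_degrees.
pose B : set (RT * RT) := `]1, b[%classic `*` `](- k), (- m)[%classic.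
apply: (@probability_lt_gap _ _ _ _ _ B ([set 0] `*` setT)).
- by apply: measurable_sign_ne => //; exact: measurable_lin.
- exact: measurableX.
- exact: measurableX.
- by apply: measurable_lt0; apply: measurable_funM.
- exact: null_fst0.
- suff : (0 < N `]1%R, b[%classic * N `](- k)%R, (- m)%R[%classic)%E.
    by move/lt_le_trans; apply; rewrite le_eqVlt; apply/orP; left; apply/eqP;
      apply/esym; exact: product_measure1E.
  by apply: mule_gt0; apply: normal_prob_itvoo_gt0 => //; rewrite ltrN2.
- have EB (u v : R) : 1 < u -> u < b -> v < - m -> u * (s * u + c * v) < 0.
    move=> u1 ub vm; have u0 : 0 < u by rewrite (lt_trans _ u1).
    rewrite pmulr_rlt0//.
    have : s * u < s * b by rewrite ltr_pM2l.
    have : c * v < c * - m by rewrite ltr_pM2l.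
    by rewrite mulrN (mulrC c m) mc; move: (s * u) (c * v) (s * b) => x y z; lra.
  move=> [u v] [] /=; rewrite !in_itv/= => /andP[u1 ub] /andP[_ vm].
  exact: EB.
- have key (u v : R) : (0 < u) != (0 < r * u + t * v) ->
      (u * (s * u + c * v) < 0 /\ ~ (1 < u /\ - k < v)) \/ u = 0.
    have -> : r * u + t * v = t * (k * u + v) by rewrite rE; ring.
    rewrite pmulr_rgt0//; case: (ltrgtP u 0) => [u0|u0|->]; last by right.
      rewrite /= eq_sym eqbF_neg negbK => h; left; split; last by case=> + _; lra.
      rewrite nmulr_rlt0//.
      have : 0 < c * (k * u + v) by rewrite mulr_gt0.
      have : k * c * u < s * u by rewrite ltr_nM2r.
      by rewrite mulrDr mulrA (mulrC c k); move: (k * c * u) (s * u) (c * v) => x y z; lra.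
    rewrite /= eq_sym eqb_id -leNgt => h; left; split.
      rewrite pmulr_rlt0//.
      have : c * (k * u + v) <= 0 by rewrite pmulr_rle0.
      have : s * u < k * c * u by rewrite ltr_pM2r.
      by rewrite mulrDr mulrA (mulrC c k); move: (k * c * u) (s * u) (c * v) => x y z; lra.
    case=> u1 kv.
    have : k * 1 < k * u by rewrite ltr_pM2l.
    by lra.
  move=> [u v] /= /key[[Euv nB]|->]; last by right; split.
  left; split => // -[] /=; rewrite !in_itv/= => /andP[u1 _] /andP[kv _].
  exact: nB.
Qed.

End normal_pair_signs.

(** * Linear combinations of two independent normals *)

Section normal_sums.
Context {R : realType}.
Local Notation RT := (measurableTypeR R).
Local Notation N := (@normal_prob R 0 1).

Let measurable_scale (s : R) : measurable_fun (setT : set RT) (fun v : RT => s * v : RT).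
Proof. exact: measurable_funM. Qed.

Lemma normal_prob_scale (s : R) (A : set R) : 0 <= s -> measurable A ->
  N ((fun v => s * v) @^-1` A) = gaussian_law 0 s A.
Proof.
move=> s0 mA; rewrite /gaussian_law; case: eqVneq => [->|sn0].
  rewrite diracE; case: (boolP (0 \in A)) => A0.
    rewrite -[RHS](probability_setT N); congr (normal_prob 0 1 _).
    by apply/seteqP; split => v //= _; rewrite mul0r; exact: set_mem.
  rewrite -[RHS](measure0 N); congr (normal_prob 0 1 _).
  by apply/seteqP; split => v //=; rewrite mul0r => /mem_set; exact/negP.
transitivity (N ((fun v => 0 + s * v) @^-1` A)).
  by congr (normal_prob 0 1 _); apply/seteqP; split => v /=; rewrite add0r.
have ns : `|s| = s by rewrite ger0_norm.
by have := normal_prob_affine 0 sn0 mA; rewrite ns.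
Qed.

Let measurable_comb (a b : R) (A : set RT) : measurable A ->
  measurable [set z : RT * RT | A (a * z.1 + b * z.2)].
Proof.
move=> mA.
have mf : measurable_fun setT (fun z : RT * RT => a * z.1 + b * z.2 : RT).
  by apply: measurable_funD; exact: measurable_funM.
exact: measurable_preimageT mf mA.
Qed.

Let normal_pair_fst (B : set RT) : measurable B ->
  (N \x N)%E [set z : RT * RT | B z.1] = N B.
Proof.
move=> mB; transitivity (N B * N setT)%E; last first.
  by rewrite -[RHS]mule1; congr (_ * _)%E; exact: probability_setT.
rewrite (_ : [set z | _] = B `*` setT); first exact: product_measure1E.
by apply/seteqP; split => z //= [].
Qed.

(** Dividing by [t] makes [(a, b)] a unit vector; the combination is then [t] times the first
    coordinate of a rotated pair. *)
Let normal_pair_sum_neq0 (a b : R) (A : set RT) : a != 0 -> measurable A ->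
  (N \x N)%E [set z : RT * RT | A (a * z.1 + b * z.2)] =
  N ((fun v => Num.sqrt (a ^+ 2 + b ^+ 2) * v) @^-1` A).
Proof.
move=> a0 mA; set t := Num.sqrt _.
have ab0 : 0 < a ^+ 2 + b ^+ 2 by rewrite ltr_wpDr ?sqr_ge0// exprn_even_gt0.
have t0 : t != 0 by rewrite gt_eqF// sqrtr_gt0.
have t2 : t ^+ 2 = a ^+ 2 + b ^+ 2 by rewrite sqr_sqrtr// ltW.
have cs : (a / t) ^+ 2 + (b / t) ^+ 2 = 1.
  by rewrite !expr_div_n -mulrDl -t2 divff// expf_neq0.
have c0 : a / t != 0 by rewrite mulf_neq0// invr_neq0.
have mtA : measurable ((fun v : RT => t * v) @^-1` A).
  exact: measurable_preimageT (measurable_scale t) mA.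
pose S := [set z : RT * RT | A (t * z.1)].
have mS : measurable S.
  rewrite (_ : S = [set z : RT * RT | A (t * z.1 + 0 * z.2)]); first exact: measurable_comb.
  by apply/seteqP; split => z; rewrite /S/= mul0r addr0.
rewrite -(normal_pair_fst mtA).
transitivity ((N \x N)%E [set z : RT * RT | S (a / t * z.1 + b / t * z.2, z.2)]).
  have lin (x y : R) : t * (a / t * x + b / t * y) = a * x + b * y.
    by field.
  by congr ((N \x N)%E _); apply/seteqP; split => z; rewrite /S/= lin.
exact: (normal_pair_rotation c0 cs erefl mS).
Qed.

Lemma normal_pair_sum (a b : R) (A : set RT) : measurable A ->
  (N \x N)%E [set z : RT * RT | A (a * z.1 + b * z.2)] =
  N ((fun v => Num.sqrt (a ^+ 2 + b ^+ 2) * v) @^-1` A).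
Proof.
move=> mA; have [a0|a0] := eqVneq a 0; last exact: normal_pair_sum_neq0.
have [b0|b0] := eqVneq b 0.
  rewrite a0 b0 expr0n addr0 sqrtr0.
  transitivity ((N \x N)%E [set z : RT * RT | A (0 * z.1)]).
    by congr ((N \x N)%E _); apply/seteqP; split => z /=; rewrite !mul0r addr0.
  apply: (normal_pair_fst (B := (fun v : RT => 0 * v) @^-1` A)).
  exact: measurable_preimageT (measurable_scale 0) mA.
rewrite addrC -(normal_pair_sum_neq0 _ b0 mA).
transitivity ((N \x N)%E
    [set z : RT * RT | [set w : RT * RT | A (b * w.1 + a * w.2)] (z.2, z.1)]).
  by congr ((N \x N)%E _); apply/seteqP; split => z /=; rewrite addrC.
by apply: (@product_measure_swap R _ _ _ _ N N); exact: measurable_comb.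
Qed.

End normal_sums.

(** * Color processes *)

Section finitely_valued.
Context d (T : measurableType d) (R : realType) (P : probability T R).
Context (F : finType) (X : T -> F).
Hypothesis mX : forall x, measurable [set t | X t = x].

Let finitely_valuedE (A : pred F) :
  [set t | A (X t)] = \bigcup_(x in [set` A]) [set t | X t = x].
Proof.
by apply/seteqP; split => [t At|t [x Ax /= Xt]]; [exists (X t)|rewrite Xt].
Qed.

Lemma measurable_finitely_valued (A : pred F) : measurable [set t | A (X t)].
Proof. by rewrite finitely_valuedE; exact: fin_bigcup_measurable. Qed.

Lemma probability_finitely_valued (A : pred F) :
  P [set t | A (X t)] = (\sum_(x | A x) P [set t | X t = x])%E.
Proof.
rewrite finitely_valuedE (measure_fin_bigcup P)//.
  rewrite (@bigfs _ _ _ _ (index_enum F)) ?index_enum_uniq// => i.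
  by rewrite mem_index_enum.
by move=> x y _ _ [t [/= <- <-]].
Qed.

End finitely_valued.

Section colors.
Context {R : realType} (S : finType) (p : R).

Let pmf_sum : bernoulli_pmf p true + bernoulli_pmf p false = 1.
Proof. by rewrite /bernoulli_pmf subrKC. Qed.

Let weight (e : {set S} -> bool) : R := \prod_(B : {set S}) bernoulli_pmf p (e B).

(** The sum over colorings of a product family factorizes over the blocks: [B] and [B'] contribute
    their fixed color, every other block the total mass 1. *)
Let sum_weight_fixed (B B' : {set S}) (b b' : bool) : B != B' ->
  \sum_(e : {ffun {set S} -> bool} | (e B == b) && (e B' == b')) weight e =
  bernoulli_pmf p b * bernoulli_pmf p b'.
Proof.
move=> BB'.
pose Q (C : {set S}) (x : bool) :=
  if C == B then x == b else if C == B' then x == b' else true.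
transitivity (\sum_(e in family Q) weight e).
  apply: eq_bigl => /= e; apply/andP/familyP => [[/eqP eB /eqP eB'] C|eQ].
    rewrite unfold_in /Q; case: eqP => [->|_]; first exact/eqP.
    by case: eqP => [->|//]; apply/eqP.
  have := eQ B; have := eQ B'.
  by rewrite !unfold_in /Q !eqxx eq_sym (negPf BB').
rewrite -(bigA_distr_big_dep Q (fun=> bernoulli_pmf p)).
rewrite (bigD1 B)//= (bigD1 B') 1?eq_sym//= [X in _ * (_ * X)]big1 ?mulr1.
  by rewrite /Q eqxx eq_sym (negPf BB') eqxx !big_pred1_eq.
move=> C /andP[/negPf CB /negPf CB'].
by rewrite /Q CB CB' big_bool.
Qed.

Lemma sum_weight_ne (B B' : {set S}) :
  \sum_(e : {ffun {set S} -> bool} | e B != e B') weight e =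
  2 * p * (1 - p) * (B != B')%:R.
Proof.
have [->|BB'] := eqVneq B B'.
  by rewrite mulr0 big1// => e; rewrite eqxx.
rewrite mulr1 (bigID (fun e : {ffun {set S} -> bool} => e B))/=.
transitivity (bernoulli_pmf p true * bernoulli_pmf p false +
              bernoulli_pmf p false * bernoulli_pmf p true); last first.
  by rewrite /bernoulli_pmf; ring.
rewrite -(sum_weight_fixed true false BB') -(sum_weight_fixed false true BB').
by congr (_ + _); apply: eq_bigl => e; case: (e B); case: (e B').
Qed.

End colors.

(** If one of [a], [b], [c] equals [e], its two terms on the left are the other two terms on the
    right, and the third left term is at most 1. If none does, the right-hand side is 4. *)
Lemma bool_ne_triangle (T : eqType) (a b c e : T) :
  ((a != b) + (a != c) + (b != c) <= (a != e) + (b != e) + (c != e) + 1)%N.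
Proof.
case: (eqVneq a e) => [?|ae]; case: (eqVneq b e) => [?|be];
  case: (eqVneq c e) => [?|ce]; subst;
  by rewrite ?eqxx ?(eq_sym e) ?(negPf ae) ?(negPf be) ?(negPf ce) //;
    do ?case: (_ == _).
Qed.

Section color_process_bound.
Context d (T : measurableType d) (R : realType) (P : probability T R).
Context (S : finType) (Y : S -> T -> bool).

Let disagree (i j : S) : R := fine (P [set t | Y i t != Y j t]).

(** [bool_ne_triangle] is applied to the blocks of the four points and averaged over the random
    partition. *)
Lemma color_process_disagreement (a b c e : S) :
  (forall i, measurable [set t | Y i t]) -> color_process P Y ->
  disagree a b + disagree a c + disagree b c <=
  disagree a e + disagree b e + disagree c e + 1 / 2.
Proof.
move=> mY [p [/andP[p0 p1] [d' [T' [P' [part [col [[mpart [_ [mcol indep]]] law]]]]]]]].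
(* Partition and full coloring form one finitely valued variable, whose probability mass function is
   the product formula [indep]. *)
pose Z t := (part t, [ffun B => col B t]).
pose w (e : {set S} -> bool) : R := \prod_(B : {set S}) bernoulli_pmf p (e B).
have ZE Q (f : {ffun {set S} -> bool}) :
    [set t | Z t = (Q, f)] = [set t | part t = Q /\ forall B, col B t = f B].
  apply/seteqP; split => t /=; first by case=> -> <-; split => // B; rewrite ffunE.
  by case=> tQ h; rewrite /Z tQ; congr (_, _); apply/ffunP => B; rewrite ffunE h.
have mcolb B (v : bool) : measurable [set t | col B t = v].
  by have := mcol B measurableT [set v] I; rewrite setTI.
have mZ x : measurable [set t | Z t = x].
  case: x => Q f; rewrite ZE.
  rewrite (_ : [set t | _] = [set t | part t = Q] `&`
      \bigcap_(B in [set: {set S}]) [set t | col B t = f B]).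
    apply: measurableI => //; apply: fin_bigcap_measurable => //.
  apply/seteqP; split => t /= [tQ tf]; split => // B; first by move=> _; exact: tf.
  exact: tf.
pose D i j (x : {set {set S}} * {ffun {set S} -> bool}) :=
  x.2 (finset.pblock x.1 i) != x.2 (finset.pblock x.1 j).
have lawD i j : P [set t | Y i t != Y j t] = P' [set t | D i j (Z t)].
  pose F t := [ffun k => Y k t]; pose F' t := [ffun k => col (finset.pblock (part t) k) t].
  have FE y : [set t | F t = y] = [set t | forall k, Y k t = y k].
    apply/seteqP; split => t /=; first by move=> <- k; rewrite ffunE.
    by move=> h; apply/ffunP => k; rewrite ffunE h.
  have F'E y : [set t | F' t = y] =
      [set t | forall k, col (finset.pblock (part t) k) t = y k].
    apply/seteqP; split => t /=; first by move=> <- k; rewrite ffunE.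
    by move=> h; apply/ffunP => k; rewrite ffunE h.
  have mF y : measurable [set t | F t = y].
    rewrite FE (_ : [set t | _] = \bigcap_(k in [set: S]) [set t | Y k t = y k]).
      apply: fin_bigcap_measurable => // k _.
      case: (y k); first exact: mY.
      rewrite (_ : [set t | _] = ~` [set t | Y k t]); first exact/measurableC/mY.
      by apply/seteqP; split => t /=; case: (Y k t).
    by apply/seteqP; split => t /= h k; [move=> _; exact: h|exact: h].
  have mF' y : measurable [set t | F' t = y].
    rewrite (_ : [set t | _] = [set t |
      [forall k, (Z t).2 (finset.pblock (Z t).1 k) == y k]]).
      exact: (measurable_finitely_valued mZ (fun x =>
        [forall k, x.2 (finset.pblock x.1 k) == y k])).
    rewrite F'E; apply/seteqP; split => t /= h; last first.
      by move=> k; have := forallP h k; rewrite ffunE => /eqP.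
    by apply/forallP => k; rewrite ffunE h.
  rewrite (_ : [set t | Y i t != Y j t] = [set t | F t i != F t j]); last first.
    by apply/seteqP; split => t /=; rewrite !ffunE.
  rewrite (_ : [set t | D i j (Z t)] = [set t | F' t i != F' t j]); last first.
    by apply/seteqP; split => t /=; rewrite /D /= !ffunE.
  rewrite (probability_finitely_valued P mF (fun y : {ffun S -> bool} => y i != y j)).
  rewrite (probability_finitely_valued P' mF' (fun y : {ffun S -> bool} => y i != y j)).
  by apply: eq_bigr => y _; rewrite FE F'E.
pose q Q := fine (P' [set t | part t = Q]).
have qE Q : P' [set t | part t = Q] = (q Q)%:E.
  by rewrite /q fineK//; exact: fin_num_measure.
have sum_q : \sum_Q q Q = 1.
  apply: EFin_inj; rewrite -sumEFin -(probability_setT P').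
  rewrite (_ : setT = [set t | predT (part t)]); last by apply/seteqP; split.
  rewrite (probability_finitely_valued P' mpart).
  by apply: eq_bigr => Q _; rewrite qE.
(* Given the partition [Q], two points in distinct blocks disagree with probability
   [2 * p * (1 - p)], and two points in the same block never do. *)
have disE i j : disagree i j =
    \sum_Q q Q * (2 * p * (1 - p) * (finset.pblock Q i != finset.pblock Q j)%:R).
  rewrite /disagree lawD (probability_finitely_valued P' mZ).
  rewrite (eq_bigr (fun x : {set {set S}} * {ffun {set S} -> bool} =>
    (q x.1 * w x.2)%:E)); last first.
    by case=> Q f _; rewrite ZE indep qE -EFinM.
  rewrite sumEFin /=.
  rewrite (eq_bigl (fun x => predT x.1 && D i j (x.1, x.2))); last by case.
  rewrite -(pair_big_dep predT (fun Q f => D i j (Q, f))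
    (fun Q (f : {ffun {set S} -> bool}) => q Q * w f))/=.
  apply: eq_bigr => Q _; rewrite -big_distrr/=; congr (_ * _).
  by rewrite -sum_weight_ne.
have half : \sum_Q q Q * (1 / 2) = 1 / 2 by rewrite -mulr_suml sum_q mul1r.
rewrite !disE -half -!big_split/=.
apply: ler_sum => Q _; rewrite -!mulrDr.
have q0 : 0 <= q Q by rewrite /q fine_ge0.
rewrite ler_wpM2l// -!natrD.
have k0 : 0 <= 2 * p * (1 - p) by rewrite !mulr_ge0// subr_ge0.
have k1 : 2 * p * (1 - p) <= 1 / 2 by have := sqr_ge0 (2 * p - 1); nra.
have := bool_ne_triangle (finset.pblock Q a) (finset.pblock Q b)
  (finset.pblock Q c) (finset.pblock Q e).
rewrite -(ler_nat R) [leRHS]natrD => /(ler_wpM2l k0) /le_trans; apply.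
by rewrite mulrDr mulr1 lerD2l.
Qed.
End color_process_bound.

(** * The Gaussian vectors *)

Section four_normals.
Context {R : realType}.
Local Notation RT := (measurableTypeR R).
Local Notation N := (@normal_prob R 0 1).
Local Notation T4 := ((RT * RT) * (RT * RT))%type.

(** Four independent standard normals, grouped in pairs so that the results on [N \x N] apply to
    each half. *)
Definition normal4 : probability T4 R := ((N \x N) \x (N \x N))%E.

Definition lin4 (b0 b1 b2 b3 : R) (t : T4) : R :=
  b0 * t.1.1 + b1 * t.1.2 + (b2 * t.2.1 + b3 * t.2.2).

Let lin2 (a b : R) (z : RT * RT) : RT := a * z.1 + b * z.2.

Let measurable_lin2 a b : measurable_fun setT (lin2 a b).
Proof. by apply: measurable_funD; exact: measurable_funM. Qed.

Let measurable_scale (s : R) : measurable_fun setT (fun v : RT => s * v : RT).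
Proof. exact: measurable_funM. Qed.

Lemma measurable_lin4 b0 b1 b2 b3 : measurable_fun setT (lin4 b0 b1 b2 b3).
Proof.
apply: (@measurable_funD _ T4 R setT (lin2 b0 b1 \o fst) (lin2 b2 b3 \o snd)).
  exact: (measurableT_comp (measurable_lin2 b0 b1) measurable_fst).
exact: (measurableT_comp (measurable_lin2 b2 b3) measurable_snd).
Qed.

HB.instance Definition _ b0 b1 b2 b3 :=
  isMeasurableFun.Build _ _ _ _ (lin4 b0 b1 b2 b3) (measurable_lin4 b0 b1 b2 b3).

Let sigma (a b : R) := Num.sqrt (a ^+ 2 + b ^+ 2).

Let lin2_law a b (B : set RT) : measurable B ->
  (N \x N)%E (lin2 a b @^-1` B) = N ((fun v => sigma a b * v) @^-1` B).
Proof. exact: normal_pair_sum. Qed.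

Let measurable_add d1 d2 (T1 : measurableType d1) (T2 : measurableType d2)
    (f : T1 -> RT) (g : T2 -> RT) (A : set RT) :
  measurable_fun setT f -> measurable_fun setT g -> measurable A ->
  measurable [set z : T1 * T2 | A (f z.1 + g z.2)].
Proof.
move=> mf mg mA.
apply: (@measurable_preimageT _ _ _ RT (fun z : T1 * T2 => f z.1 + g z.2 : RT)) => //.
apply: (@measurable_funD _ _ R setT (f \o fst) (g \o snd)).
  exact: (measurableT_comp mf measurable_fst).
exact: (measurableT_comp mg measurable_snd).
Qed.

Lemma lin4_law b0 b1 b2 b3 (A : set R) : measurable A ->
  normal4 (lin4 b0 b1 b2 b3 @^-1` A) =
  gaussian_law 0 (Num.sqrt (b0 ^+ 2 + b1 ^+ 2 + (b2 ^+ 2 + b3 ^+ 2))) A.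
Proof.
move=> mA; rewrite -normal_prob_scale ?sqrtr_ge0//.
pose S1 := [set z : (RT * RT) * RT | A (lin2 b0 b1 z.1 + z.2)].
have mS1 : measurable S1.
  by apply: (measurable_add (f := lin2 b0 b1) (g := id)).
transitivity (((N \x N) \x N)%E [set z | S1 (z.1, sigma b2 b3 * z.2)]).
  exact: (@product_measure_transport_snd _ _ _ _ _ _ _ _ _
    (N \x N)%E (N \x N)%E N _ _ (lin2_law b2 b3) _ mS1).
pose S2 := [set z : RT * RT | A (z.1 + sigma b2 b3 * z.2)].
have mS2 : measurable S2.
  exact: (measurable_add (f := id) (g := fun v : RT => sigma b2 b3 * v : RT)
    (@measurable_id _ _ _) (measurable_scale _) mA).
transitivity ((N \x N)%E [set z | S2 (sigma b0 b1 * z.1, z.2)]).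
  exact: (@product_measure_transport_fst _ _ _ _ _ _ _ _ _
    N (N \x N)%E N _ _ (lin2_law b0 b1) _ (measurable_lin2 _ _) (measurable_scale _) mS2).
have sq (x y : R) : sigma x y ^+ 2 = x ^+ 2 + y ^+ 2.
  by rewrite sqr_sqrtr// addr_ge0 ?sqr_ge0.
by rewrite -(sq b0 b1) -(sq b2 b3); exact: normal_pair_sum.
Qed.

(** The last three normals merge into one independent of the first: merge the second half,
    reassociate, then merge the remaining two. *)
Lemma normal4_pair b1 b2 b3 (S : set (RT * RT)) : measurable S ->
  normal4 [set t | S (t.1.1, b1 * t.1.2 + (b2 * t.2.1 + b3 * t.2.2))] =
  (N \x N)%E [set z | S (z.1, Num.sqrt (b1 ^+ 2 + (b2 ^+ 2 + b3 ^+ 2)) * z.2)].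
Proof.
move=> mS.
pose S1 := [set z : (RT * RT) * RT | S (z.1.1, b1 * z.1.2 + z.2)].
have mS1 : measurable S1.
  apply: (@measurable_preimageT _ _ _ (RT * RT)%type
    (fun z : (RT * RT) * RT => (z.1.1, b1 * z.1.2 + z.2) : RT * RT)) => //.
  apply: (measurable_fun_pair (f := fst \o fst)).
    exact: (measurableT_comp measurable_fst measurable_fst).
  apply: measurable_funD; last exact: measurable_snd.
  apply: measurable_funM => //.
  exact: (measurableT_comp measurable_snd measurable_fst).
transitivity (((N \x N) \x N)%E [set z | S1 (z.1, sigma b2 b3 * z.2)]).
  exact: (@product_measure_transport_snd _ _ _ _ _ _ _ _ _
    (N \x N)%E (N \x N)%E N _ _ (lin2_law b2 b3) _ mS1).
pose S2 := [set z : RT * (RT * RT) | S (z.1, lin2 b1 (sigma b2 b3) z.2)].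
have mS2 : measurable S2.
  apply: (@measurable_preimageT _ _ _ (RT * RT)%type
    (fun z : RT * (RT * RT) => (z.1, lin2 b1 (sigma b2 b3) z.2) : RT * RT)) => //.
  apply: measurable_fun_pair => //.
  exact: (measurableT_comp (measurable_lin2 _ _) measurable_snd).
transitivity ((N \x (N \x N))%E S2).
  exact: (@product_measure_assoc _ _ _ _ _ _ _ N N N _ mS2).
have sq (x y : R) : sigma x y ^+ 2 = x ^+ 2 + y ^+ 2.
  by rewrite sqr_sqrtr// addr_ge0 ?sqr_ge0.
rewrite -(sq b2 b3).
exact: (@product_measure_transport_snd _ _ _ _ _ _ _ _ _
  N (N \x N)%E N _ _ (lin2_law b1 (sigma b2 b3)) _ mS).
Qed.

End four_normals.

Section four_normals_signs.
Context {R : realType}.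
Local Notation RT := (measurableTypeR R).
Local Notation N := (@normal_prob R 0 1).
Local Notation T4 := ((RT * RT) * (RT * RT))%type.

(** Together with [normal4_swap], this brings any sign comparison to one that involves the first
    coordinate. *)
Lemma normal4_swap_fst (Q : set T4) : measurable Q ->
  normal4 [set t | Q ((t.1.2, t.1.1), t.2)] = normal4 Q.
Proof.
move=> mQ.
pose sw (z : RT * RT) : RT * RT := (z.2, z.1).
have msw : measurable_fun setT sw.
  exact: (measurable_fun_pair measurable_snd measurable_fst).
have swE (B : set (RT * RT)) : measurable B ->
    (N \x N)%E (sw @^-1` B) = (N \x N)%E (id @^-1` B).
  by move=> mB; exact: (@product_measure_swap _ _ _ _ _ N N).
transitivity (normal4 [set t : T4 | Q (id t.1, t.2)]); last first.
  by congr (normal4 _); apply/seteqP; split => -[].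
exact: (@product_measure_transport_fst _ _ _ _ _ _ _ _ _
  (N \x N)%E (N \x N)%E (N \x N)%E sw id swE Q msw (@measurable_id _ _ _) mQ).
Qed.

Lemma normal4_swap (Q : set T4) : measurable Q ->
  normal4 [set t | Q (t.2, t.1)] = normal4 Q.
Proof.
exact: (@product_measure_swap _ _ _ _ _ (N \x N)%E (N \x N)%E).
Qed.

Let measurable_sign_lin (a : R) : measurable [set z : RT * RT |
  (0 < z.1) != (0 < a * z.1 + z.2)].
Proof.
apply: measurable_sign_ne; first exact: measurable_fst.
by apply: measurable_funD; [exact: measurable_funM|exact: measurable_snd].
Qed.

Lemma normal4_sign_ne_lt (r b1 b2 b3 : R) :
  1 / 2 < r -> r < 1 -> r ^+ 2 + (b1 ^+ 2 + (b2 ^+ 2 + b3 ^+ 2)) = 1 ->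
  (normal4 [set t : T4 | ((0 < t.1.1) !=
    (0 < r * t.1.1 + (b1 * t.1.2 + (b2 * t.2.1 + b3 * t.2.2))))%R] < (1 / 3)%:E)%E.
Proof.
move=> r2 r1; set w := b1 ^+ 2 + _ => rw.
have w0 : 0 < w by nra.
apply: le_lt_trans (@normal_pair_sign_ne_lt R r (Num.sqrt w) r2 _ _).
- rewrite le_eqVlt; apply/orP; left; apply/eqP.
  exact: (normal4_pair b1 b2 b3 (measurable_sign_lin r)).
- by rewrite sqrtr_gt0.
- by rewrite sqr_sqrtr// ltW.
Qed.

Lemma normal4_sign_ne_ge (b1 b2 b3 : R) : b1 ^+ 2 + (b2 ^+ 2 + b3 ^+ 2) = 1 ->
  ((1 / 2)%:E <= normal4 [set t : T4 | ((0 < t.1.1) !=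
    (0 < b1 * t.1.2 + (b2 * t.2.1 + b3 * t.2.2)))%R])%E.
Proof.
move=> b1E; apply: le_trans (@normal_pair_sign_ne_ge R) _.
rewrite le_eqVlt; apply/orP; left; apply/eqP/esym.
have mS : measurable [set z : RT * RT | (0 < z.1) != (0 < z.2)].
  by apply: measurable_sign_ne; [exact: measurable_fst|exact: measurable_snd].
rewrite (normal4_pair b1 b2 b3 mS) b1E sqrtr1.
congr ((N \x N)%E _).
by apply/seteqP; split => z /=; rewrite mul1r.
Qed.

End four_normals_signs.

(** * The vector of the counterexample *)

Section tilted_vector.
Context {R : realType} (r s : R).
Hypothesis rs1 : 3 * r ^+ 2 + s ^+ 2 = 1.
Hypothesis r_gt : 1 / 2 < r.
Hypothesis s_ge0 : 0 <= s.
Local Notation RT := (measurableTypeR R).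
Local Notation T4 := ((RT * RT) * (RT * RT))%type.
Local Notation P := (@normal4 R).

(** Rows 0 to 2 are unit vectors, row 3 is [(r, r, r, s)]. *)
Let coef (i k : nat) : R :=
  if i == 3%N then (if k == 3%N then s else r) else (i == k)%:R.

Definition tilted_vector (i : 'I_4) : {RV P >-> R} :=
  lin4 (coef i 0) (coef i 1) (coef i 2) (coef i 3).

Local Notation X := tilted_vector.

Let r_lt1 : r < 1.
Proof.
rewrite ltNge; apply/negP => r1; have s2 := sqr_ge0 s.
have : 1 <= r ^+ 2 by rewrite expr_ge1//; lra.
by move: rs1; lra.
Qed.

(** The covariance of the components [i] and [j], since the underlying normals are independent and
    standard. *)
Let dot (i j : nat) : R := coef i 0 * coef j 0 + coef i 1 * coef j 1 +
  (coef i 2 * coef j 2 + coef i 3 * coef j 3).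

Let dot_self (i : 'I_4) : dot i i = 1.
Proof.
case: i => -[|[|[|[|//]]]] i; rewrite /dot /coef /=; try ring.
by rewrite -rs1; ring.
Qed.

Let dot_ge0 (i j : 'I_4) : 0 <= dot i j.
Proof.
have c0 a k : 0 <= coef a k.
  by rewrite /coef; case: ifP => _; [case: ifP => // _; move: r_gt; lra|exact: ler0n].
by rewrite /dot !addr_ge0// mulr_ge0.
Qed.

Let dot_lt1 (i j : 'I_4) : i != j -> dot i j < 1.
Proof.
by case: i => -[|[|[|[|//]]]] i; case: j => -[|[|[|[|//]]]] j //= _;
  rewrite /dot /coef /= ?mul0r ?mulr0 ?mul1r ?mulr1 ?add0r ?addr0 ?ltr01.
Qed.

Let lin4_std b0 b1 b2 b3 (A : set R) : measurable A ->
  b0 ^+ 2 + b1 ^+ 2 + (b2 ^+ 2 + b3 ^+ 2) = 1 ->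
  P (lin4 b0 b1 b2 b3 @^-1` A) = normal_prob 0 1 A.
Proof. by move=> mA b1E; rewrite lin4_law// b1E sqrtr1 /gaussian_law oner_eq0. Qed.

Let X_law i (A : set R) : measurable A -> P (X i @^-1` A) = normal_prob 0 1 A.
Proof. by move=> mA; apply: lin4_std => //; rewrite !expr2; exact: dot_self. Qed.

Lemma tilted_vector_standard : standard_gaussian_vector X.
Proof.
split=> [a|]; last first.
  split=> i; [apply: normal_law_expectation|apply: normal_law_variance] => A;
  exact: X_law.
pose b k := \sum_(i < 4) a i * coef i k.
exists 0, (Num.sqrt (b 0%N ^+ 2 + b 1%N ^+ 2 + (b 2%N ^+ 2 + b 3%N ^+ 2))) => A mA.
transitivity (P (lin4 (b 0%N) (b 1%N) (b 2%N) (b 3%N) @^-1` A)); last exact: lin4_law.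
have E t : \sum_(i < 4) a i * X i t = lin4 (b 0%N) (b 1%N) (b 2%N) (b 3%N) t.
  rewrite /b /X /tilted_vector /lin4 !big_ord_recl !big_ord0 /=.
  by rewrite /coef/= /lin4; ring.
by congr (P _); apply/seteqP; split => t /=; rewrite E.
Qed.

(** The difference of two components is normal with variance [2 - 2 * dot i j > 0], hence vanishes
    with probability zero. *)
Lemma tilted_vector_nondegenerate : nondegenerate_vector X.
Proof.
move=> i j ij.
pose c k := coef i k - coef j k.
pose sig := Num.sqrt (c 0%N ^+ 2 + c 1%N ^+ 2 + (c 2%N ^+ 2 + c 3%N ^+ 2)).
have sig0 : sig != 0.
  rewrite gt_eqF// sqrtr_gt0.
  have -> : c 0%N ^+ 2 + c 1%N ^+ 2 + (c 2%N ^+ 2 + c 3%N ^+ 2) =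
      dot i i + dot j j - 2 * dot i j by rewrite /c /dot; ring.
  by rewrite !dot_self; have := dot_lt1 ij; lra.
pose A := lin4 (c 0%N) (c 1%N) (c 2%N) (c 3%N) @^-1` [set 0].
have E t : lin4 (c 0%N) (c 1%N) (c 2%N) (c 3%N) t = X i t - X j t.
  by rewrite /tilted_vector /= /lin4 /c; ring.
have A0 : P A = 0%E.
  by rewrite lin4_law// -/sig /gaussian_law (negPf sig0) normal_prob_set1.
have mA : measurable A by apply: measurable_preimageT => //; exact: measurable_lin4.
rewrite (_ : [set t | _] = ~` A); first by rewrite probability_setC// A0 sube0.
apply/funext => t; apply/propext; rewrite /A /setC /preimage /= E.
split; first by move/eqP => h /eqP; rewrite subr_eq0 => /eqP.
by move=> h; apply/eqP => /eqP; rewrite -subr_eq0 => /eqP.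
Qed.

(** Polarization: the sum of two components has variance [v = 2 + 2 * dot i j], read off from its
    normalization [Y], and [varianceD] turns this into the covariance. *)
Lemma tilted_vector_covariance_ge0 : nonnegative_correlations X.
Proof.
move=> i j.
have X2 k : (X k : T4 -> R) \in Lfun P 2%:E.
  by apply: normal_law_Lfun2 => A; exact: X_law.
have X1 k : (X k : T4 -> R) \in Lfun P 1.
  by apply: normal_law_Lfun1 => A; exact: X_law.
pose c k := coef i k + coef j k.
pose v := c 0%N ^+ 2 + c 1%N ^+ 2 + (c 2%N ^+ 2 + c 3%N ^+ 2).
have vE : v = 2 + 2 * dot i j.
  have -> : v = dot i i + dot j j + 2 * dot i j by rewrite /v /c /dot; ring.
  by rewrite !dot_self; ring.
have v2 : 2 <= v by rewrite vE; have := dot_ge0 i j; lra.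
have v0 : 0 < v by exact: lt_le_trans v2.
pose sig := Num.sqrt v.
have sig0 : sig != 0 by rewrite gt_eqF// sqrtr_gt0.
have sig2 : sig ^+ 2 = v by rewrite sqr_sqrtr// ltW.
pose Y : {RV P >-> R} := lin4 (c 0%N / sig) (c 1%N / sig) (c 2%N / sig) (c 3%N / sig).
have YN (A : set R) : measurable A -> P (Y @^-1` A) = normal_prob 0 1 A.
  move=> mA; apply: lin4_std => //; rewrite !expr_div_n -!mulrDl sig2 divff//.
  by rewrite gt_eqF.
have V : ('V_P[X i \+ X j]%R = v%:E)%E.
  rewrite (_ : (X i \+ X j)%R = (sig \o* (Y : T4 -> R))%R).
    rewrite varianceZ; last by apply: normal_law_Lfun2 => A; exact: YN.
    by rewrite (normal_law_variance YN) mule1 sig2.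
  apply/funext => t; rewrite /Y /tilted_vector/= /lin4 /c.
  by field.
have := varianceD (X2 i) (X2 j); rewrite V.
have VX k : ('V_P[X k] = 1)%E by apply: normal_law_variance => A; exact: X_law.
rewrite !VX.
have := covariance_fin_num (X1 i) (X1 j) (Lfun2_mul_Lfun1 (X2 i) (X2 j)).
case: (covariance P (X i) (X j)) => // u _.
rewrite -!EFinM -!EFinD => -[E]; rewrite lee_fin.
by lra.
Qed.

Let X_val (i : 'I_4) (t : T4) : X i t =
  match val i with
  | 0%N => t.1.1 | 1%N => t.1.2 | 2%N => t.2.1
  | _ => r * t.1.1 + r * t.1.2 + (r * t.2.1 + s * t.2.2)
  end.
Proof.
case: i => -[|[|[|[|//]]]] i; rewrite /tilted_vector/= /lin4 /coef/=;
  by rewrite ?mul1r ?mul0r ?addr0 ?add0r.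
Qed.

Let disagreement (i j : 'I_4) : set T4 :=
  [set t | threshold 0 X i t != threshold 0 X j t].

Let measurable_disagreement i j : measurable (disagreement i j).
Proof. by apply: measurable_sign_ne; exact: measurable_lin4. Qed.

Let o0 : 'I_4 := Ordinal (isT : 0 < 4)%N.
Let o1 : 'I_4 := Ordinal (isT : 1 < 4)%N.
Let o2 : 'I_4 := Ordinal (isT : 2 < 4)%N.
Let o3 : 'I_4 := Ordinal (isT : 3 < 4)%N.

Let disagreementE i j t :
  disagreement i j t = ((0 < X i t) != (0 < X j t)) :> Prop.
Proof. by []. Qed.

Let disagreement01 : ((1 / 2)%:E <= P (disagreement o0 o1))%E.
Proof.
have -> : disagreement o0 o1 = [set t | (0 < t.1.1) !=
    (0 < 1 * t.1.2 + (0 * t.2.1 + 0 * t.2.2))].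
  apply/funext => t; rewrite disagreementE !X_val/=.
  by rewrite mul1r !mul0r !addr0.
by apply: normal4_sign_ne_ge; ring.
Qed.

Let disagreement02 : ((1 / 2)%:E <= P (disagreement o0 o2))%E.
Proof.
have -> : disagreement o0 o2 = [set t | (0 < t.1.1) !=
    (0 < 0 * t.1.2 + (1 * t.2.1 + 0 * t.2.2))].
  apply/funext => t; rewrite disagreementE !X_val/=.
  by rewrite mul1r !mul0r addr0 add0r.
by apply: normal4_sign_ne_ge; ring.
Qed.

Let disagreement12 : ((1 / 2)%:E <= P (disagreement o1 o2))%E.
Proof.
rewrite (_ : disagreement o1 o2 =
    [set t : T4 | disagreement o0 o2 ((t.1.2, t.1.1), t.2)]).
  by rewrite (normal4_swap_fst (measurable_disagreement o0 o2)).
by apply/funext => t; rewrite disagreementE /mkset disagreementE !X_val.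
Qed.

Let disagreement03 : (P (disagreement o0 o3) < (1 / 3)%:E)%E.
Proof.
have -> : disagreement o0 o3 = [set t | (0 < t.1.1) !=
    (0 < r * t.1.1 + (r * t.1.2 + (r * t.2.1 + s * t.2.2)))].
  by apply/funext => t; rewrite disagreementE !X_val/= -[in LHS]addrA.
by apply: normal4_sign_ne_lt => //; rewrite -rs1; ring.
Qed.

Let disagreement13 : (P (disagreement o1 o3) < (1 / 3)%:E)%E.
Proof.
rewrite (_ : disagreement o1 o3 =
    [set t : T4 | disagreement o0 o3 ((t.1.2, t.1.1), t.2)]).
  by rewrite (normal4_swap_fst (measurable_disagreement o0 o3)).
apply/funext => t; rewrite disagreementE /mkset disagreementE !X_val /=.
by rewrite (addrC (r * t.1.1)).
Qed.

Let disagreement23 : (P (disagreement o2 o3) < (1 / 3)%:E)%E.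
Proof.
(* Exchanging the halves puts the third normal first and the fourth, whose weight is [s], second. *)
pose Q : set T4 := [set t | (0 < t.1.1) !=
    (0 < r * t.1.1 + (s * t.1.2 + (r * t.2.1 + r * t.2.2)))].
have QE : Q = [set t | (0 < lin4 1 0 0 0 t) != (0 < lin4 r s r r t)].
  apply/funext => t; rewrite /Q /mkset /lin4 mul1r !mul0r !addr0.
  by rewrite addrA.
have mQ : measurable Q.
  by rewrite QE; apply: measurable_sign_ne; exact: measurable_lin4.
rewrite (_ : disagreement o2 o3 = [set t : T4 | Q (t.2, t.1)]).
  rewrite (normal4_swap mQ).
  by apply: normal4_sign_ne_lt => //; rewrite -rs1; ring.
apply/funext => t; rewrite disagreementE /Q /mkset !X_val /=.
by rewrite addrC -addrA.
Qed.

Lemma tilted_vector_not_color_process : ~ color_process P (threshold 0 X).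
Proof.
move=> cp.
have mX i : measurable [set t | threshold 0 X i t].
  by apply: measurable_gt0; exact: measurable_lin4.
pose q i j := fine (P (disagreement i j)).
have qE i j : P (disagreement i j) = (q i j)%:E.
  by rewrite /q fineK//; exact: fin_num_measure.
have q_ge i j : ((1 / 2)%:E <= P (disagreement i j))%E -> 1 / 2 <= q i j.
  by rewrite qE lee_fin.
have q_lt i j : (P (disagreement i j) < (1 / 3)%:E)%E -> q i j < 1 / 3.
  by rewrite qE lte_fin.
have bound : q o0 o1 + q o0 o2 + q o1 o2 <= q o0 o3 + q o1 o3 + q o2 o3 + 1 / 2.
  exact: color_process_disagreement.
move: (q_ge _ _ disagreement01) (q_ge _ _ disagreement02) (q_ge _ _ disagreement12).
move: (q_lt _ _ disagreement03) (q_lt _ _ disagreement13) (q_lt _ _ disagreement23).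
move: (q o0 o1) (q o0 o2) (q o1 o2) (q o0 o3) (q o1 o3) (q o2 o3) bound.
by move=> a b c a' b' c'; lra.
Qed.

Let ball_rowE (x : 'rV[R]_4) e t : 0 < e ->
  ball x e (\row_(i < 4) X i t) <-> forall i, `|x ord0 i - X i t| < e.
Proof.
move=> e0; split=> [[_ h] i|h]; first by have := h ord0 i; rewrite mxE.
by split => // i j; rewrite (ord1 i) mxE; exact: h.
Qed.

Lemma tilted_vector_fully_supported : 0 < s -> fully_supported X.
Proof.
move=> s0; apply/seteqP; split => // x _ e e0.
have s1 : s <= 1.
  rewrite leNgt; apply/negP => s1; have r2 := sqr_ge0 r.
  have : 1 < s ^+ 2 by rewrite expr_gt1// ltW.
  by move: rs1; lra.
pose x0 := x ord0 o0; pose x1 := x ord0 o1; pose x2 := x ord0 o2.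
(* [x3] is the value of the fourth normal that makes the last component hit its target. The
   half-width [e / 4] suffices because the weights [r], [r], [r], [s] are at most 1. *)
pose x3 := (x ord0 o3 - r * (x0 + x1 + x2)) / s.
pose J (c : R) : set RT := `](c - e / 4), (c + e / 4)[%classic.
have J_gt0 c : (0 < normal_prob 0 1 (J c))%E.
  by apply: normal_prob_itvoo_gt0; lra.
have mJ c : measurable (J c) by exact: measurable_itv.
pose B : set T4 := (J x0 `*` J x1) `*` (J x2 `*` J x3).
have B_gt0 : (0 < P B)%E.
  have -> : P B = ((normal_prob 0 1 (J x0) * normal_prob 0 1 (J x1)) *
      (normal_prob 0 1 (J x2) * normal_prob 0 1 (J x3)))%E.
    have NNE c c' : (normal_prob 0 1 \x normal_prob 0 1)%E (J c `*` J c') =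
        (normal_prob 0 1 (J c) * normal_prob 0 1 (J c'))%E.
      exact: product_measure1E.
    rewrite -!NNE; apply: product_measure1E; exact: measurableX.
  by rewrite !mule_gt0.
apply: lt_le_trans B_gt0 _; apply: le_probability.
- by apply: measurableX; exact: measurableX.
- rewrite (_ : [set t | _] =
      \bigcap_(i in [set: 'I_4]) [set t | 0 < e - `|x ord0 i - X i t|]).
    apply: fin_bigcap_measurable => // i _; apply: measurable_gt0.
    apply: measurable_funB => //; apply: measurableT_comp => //.
    by apply: measurable_funB => //; exact: measurable_lin4.
  apply/funext => t; apply/propext; split.
    by move/(ball_rowE _ _ e0) => h i _ /=; rewrite subr_gt0.
  by move=> h; apply/(ball_rowE _ _ e0) => i; have := h i I; rewrite /= subr_gt0.
have close (c z : R) : c - e / 4 < z < c + e / 4 -> `|c - z| < e / 4.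
  by move=> /andP[? ?]; rewrite ltr_norml; apply/andP; split; lra.
have e4 : e / 4 < e by lra.
move=> [[z0 z1] [z2 z3]] [[/= h0 h1] [/= h2 h3]]; apply/(ball_rowE _ _ e0) => i.
rewrite X_val; move: h0 h1 h2 h3; rewrite /J /= !in_itv /=.
move=> /close h0 /close h1 /close h2 /close h3.
case: i => -[|[|[|[|//]]]] i /=; rewrite (bool_irrelevance i isT).
- exact: lt_trans e4.
- exact: lt_trans e4.
- exact: lt_trans e4.
have near (d0 d1 d2 d3 : R) : `|d0| < e / 4 -> `|d1| < e / 4 -> `|d2| < e / 4 ->
    `|d3| < e / 4 -> `|r * d0 + r * d1 + (r * d2 + s * d3)| < e.
  have scale (a d : R) : 0 <= a -> `|d| < e / 4 -> a * `|d| <= a * (e / 4).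
    by move=> a0 d4; rewrite ler_wpM2l// ltW.
  have r0 : 0 <= r by move: r_gt; lra.
  move=> /(scale r) k0 /(scale r) k1 /(scale r) k2 /(scale s) k3.
  apply: (@le_lt_trans _ _ (r * `|d0| + r * `|d1| + (r * `|d2| + s * `|d3|))).
    rewrite -(ger0_norm r0) -(ger0_norm s_ge0) -!normrM ger0_norm// ger0_norm//.
    by rewrite (le_trans (ler_normD _ _))// lerD// ler_normD.
  move: (k0 r0) (k1 r0) (k2 r0) (k3 s_ge0).
  have : r * (e / 4) < e / 4 by rewrite gtr_pMl ?divr_gt0.
  have : s * (e / 4) <= e / 4 by rewrite ger_pMl ?divr_gt0.
  lra.
rewrite (_ : x _ _ - _ = r * (x0 - z0) + r * (x1 - z1) + (r * (x2 - z2) + s * (x3 - z3))).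
  exact: near.
have lin (a b c y u v w z : R) : y - (r * u + r * v + (r * w + s * z)) =
  r * (a - u) + r * (b - v) + (r * (c - w) + s * ((y - r * (a + b + c)) / s - z)).
  by field; rewrite gt_eqF.
exact: lin.
Qed.

(** The vector lies in a hyperplane that stays away from [(0, 0, 0, 1)]: if the first three
    components are below [1 / 4], the last is below [3 / 4]. *)
Lemma tilted_vector_not_fully_supported : s = 0 -> ~ fully_supported X.
Proof.
move=> s0 full.
pose x : 'rV[R]_4 := \row_(i < 4) (i == o3)%:R.
have : law_support X x by rewrite [law_support X]full.
have e0 : 0 < (1 / 4 : R) by lra.
move=> /(_ _ e0); rewrite (_ : [set t | _] = set0) ?measure0 ?ltxx//.
apply/seteqP; split => // t /(ball_rowE _ _ e0) h.
have := h o0; have := h o1; have := h o2; have := h o3.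
rewrite !mxE !X_val /= s0 mul0r addr0 !sub0r !normrN.
move: (t.1.1 : R) (t.1.2 : R) (t.2.1 : R) => u v w.
rewrite -!mulrDr ltr_norml => /andP[_ h3] hw hv hu.
have lt34 : u + v + w < 3 / 4.
  by move: (ltr_normlW hw) (ltr_normlW hv) (ltr_normlW hu); lra.
have r0 : 0 < r by rewrite (lt_trans _ r_gt)// divr_gt0.
have : r * (u + v + w) < r * (3 / 4) by rewrite ltr_pM2l.
have : r * (3 / 4) < 3 / 4 by rewrite gtr_pMl ?divr_gt0.
move: h3; move: (r * (u + v + w)) (r * (3 / 4)) => p q.
by lra.
Qed.

End tilted_vector.

Theorem theorem1p4 (R : realType) :
  (exists (d : measure_display) (T : measurableType d) (P : probability T R)
      (X : 'I_4 -> {RV P >-> R}),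
    standard_gaussian_vector X /\ nondegenerate_vector X /\
    nonnegative_correlations X /\
    fully_supported X /\
    ~ color_process P (threshold 0 X)) /\
  (exists (d : measure_display) (T : measurableType d) (P : probability T R)
      (X : 'I_4 -> {RV P >-> R}),
    standard_gaussian_vector X /\ nondegenerate_vector X /\
    nonnegative_correlations X /\
    ~ fully_supported X /\
    ~ color_process P (threshold 0 X)).
Proof.
split.
  have rs1 : 3 * (4 / 7) ^+ 2 + (1 / 7) ^+ 2 = 1 :> R by field.
  have r_gt : 1 / 2 < 4 / 7 :> R by lra.
  have s_gt0 : 0 < 1 / 7 :> R by lra.
  have s_ge0 := ltW s_gt0.
  do 2!eexists; exists (@normal4 R), (tilted_vector (4 / 7) (1 / 7)).
  split; first exact: tilted_vector_standard.
  split; first exact: tilted_vector_nondegenerate.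
  split; first exact: tilted_vector_covariance_ge0.
  split; first exact: tilted_vector_fully_supported.
  exact: tilted_vector_not_color_process.
pose r : R := Num.sqrt (1 / 3).
have r2 : r ^+ 2 = 1 / 3 by rewrite sqr_sqrtr//; lra.
have rs1 : 3 * r ^+ 2 + 0 ^+ 2 = 1 :> R by rewrite r2; field.
(* Otherwise [r ^+ 2] would be at most [1 / 4], less than [1 / 3]. *)
have r_gt : 1 / 2 < r.
  by rewrite ltNge; apply/negP => rle; have := sqrtr_ge0 (1 / 3 : R); rewrite -/r; nra.
do 2!eexists; exists (@normal4 R), (tilted_vector r 0).
split; first exact: tilted_vector_standard.
split; first exact: tilted_vector_nondegenerate.
split; first exact: tilted_vector_covariance_ge0.
split; first exact: tilted_vector_not_fully_supported.
exact: tilted_vector_not_color_process.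
Qed.
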